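(* Consider the sparse Boolean hypercube clustering problem $\mathbf{P}_{\mathrm{sB}}$ in dimension $d$ with $\nu=C/\sqrt d$ for a sufficiently large absolute constant $C>0$, and let $n\le c\log d$ for a sufficiently small absolute constant $c>0$. Then: (1) There is an algorithm $\mathcal{A}$ that, given a single sample ($n=1$), satisfies $\mathrm{err}(\mathcal{A},\mathbf{P}_{\mathrm{sB}})\le0.01$. (2) For every constant $\alpha<1/2$, \[ \mathrm{mem}_n(\mathbf{P}_{\mathrm{sB}},\alpha)=\Omega\!\left(\frac{(1-2\alpha)\log\frac{1-\alpha}{\alpha}}{\nu^2 2^{2n}}\right)-O(\sqrt d\log d); \] in particular $\mathrm{mem}_n(\mathbf{P}_{\mathrm{sB}})=\Omega(d/2^{2n})$. (3) There is an algorithm $\mathcal{A}$ with $\mathrm{err}(\mathcal{A},\mathbf{P}_{\mathrm{sB}})\le0.01$ and $\mathrm{mem}_n(\mathcal{A},\mathbf{P}_{\mathrm{sB}})=O(d\log(d)/2^{2n})$.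
   Context: Sparse Boolean hypercube clustering problem $\mathbf{P}_{\mathrm{sB}}$: the parameter is $\theta=(S,y)$ where $S\subseteq[d]$ contains each $i\in[d]$ independently with probability $\nu$, and $y\in\{\pm1\}^S$ has independent uniform entries. $\mathcal{P}_\theta$ is the distribution of $X\in\{\pm1\}^d$ with $X_j=y_j$ for $j\in S$ and $X_j$ independent uniform on $\{\pm1\}$ for $j\notin S$. The null distribution is $\mathcal{P}_0=\mathcal{U}(\{\pm1\}^d)$. An algorithm receives $X_{1:n}\sim\mathcal{P}_\theta^n$ and outputs a classifier $h:\{\pm1\}^d\to\{0,1\}$. $\mathrm{err}(h)=\tfrac12\Pr_{X\sim\mathcal{P}_\theta}[h(X)=0]+\tfrac12\Pr_{X\sim\mathcal{P}_0}[h(X)=1]$; $\mathrm{err}(\mathcal{A},\mathbf{P})=\mathbb{E}_{\theta,X_{1:n},h\leftarrow\mathcal{A}(X_{1:n})}[\mathrm{err}(h)]$; $\mathrm{mem}_n(\mathcal{A},\mathbf{P})=I(\mathcal{A}(X_{1:n});X_{1:n}\mid\theta)$; $\mathrm{mem}_n(\mathbf{P},\alpha)=\inf\{\mathrm{mem}_n(\mathcal{A},\mathbf{P}):\mathrm{err}(\mathcal{A},\mathbf{P})\le\alpha\}$; $\mathrm{mem}_n(\mathbf{P})=\mathrm{mem}_n(\mathbf{P},1/3)$. *)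

(* Defs.v *)
From HB Require Import structures.
From mathcomp Require Import all_boot all_order all_algebra.
From mathcomp Require Import all_classical all_reals.
From mathcomp Require Import ereal exp.
Set Implicit Arguments. Unset Strict Implicit. Unset Printing Implicit Defensive.
Import Order.TTheory GRing.Theory Num.Theory.
Local Open Scope ring_scope.

(* Points of the Boolean hypercube {±1}^d; coordinate value true = +1, false = -1. *)
Definition cube (d : nat) := {ffun 'I_d -> bool}.

(* Parameter theta = (S, y): theta j = None iff j \notin S, theta j = Some b iff
   j \in S and y_j = b. This is a bijective encoding of pairs (S, y), y \in {±1}^S. *)
Definition param (d : nat) := {ffun 'I_d -> option bool}.

Definition samples (d n : nat) := {ffun 'I_n -> cube d}.

Definition clf (d : nat) := {ffun cube d -> bool}.

Section SparseBoolean.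
Variable R : realType.
Variable d : nat.

(* Prior on theta: each i in S independently w.p. nu, y_i uniform on {±1}. *)
Definition prior (nu : R) (th : param d) : R :=
  \prod_(j : 'I_d) (match th j with None => 1 - nu | Some _ => nu / 2 end).

Definition Ptheta (th : param d) (x : cube d) : R :=
  \prod_(j : 'I_d) (match th j with
                    | None => 2^-1
                    | Some b => if x j == b then 1 else 0 end).

Definition P0 (x : cube d) : R := \prod_(j : 'I_d) (2^-1 : R).

Definition Pn (n : nat) (th : param d) (X : samples d n) : R :=
  \prod_(i : 'I_n) Ptheta th (X i).

Definition algorithm (n : nat) := samples d n -> clf d -> R.

Definition is_alg (n : nat) (A : algorithm n) : Prop :=
  forall X : samples d n, (forall h, 0 <= A X h) /\ \sum_(h : clf d) A X h = 1.

Definition err_clf (th : param d) (h : clf d) : R :=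
  2^-1 * (\sum_(x : cube d | ~~ h x) Ptheta th x)
  + 2^-1 * (\sum_(x : cube d | h x) P0 x).

Definition err (n : nat) (nu : R) (A : algorithm n) : R :=
  \sum_(th : param d) prior nu th *
    \sum_(X : samples d n) Pn th X * \sum_(h : clf d) A X h * err_clf th h.

Definition out_marg (n : nat) (A : algorithm n) (th : param d) (h : clf d) : R :=
  \sum_(X : samples d n) Pn th X * A X h.

(* mem_n(A, P) = I(A(X_{1:n}); X_{1:n} | theta) (in nats), with 0 log 0 = 0. *)
Definition memA (n : nat) (nu : R) (A : algorithm n) : R :=
  \sum_(th : param d) prior nu th *
    \sum_(X : samples d n) \sum_(h : clf d)
      (if 0 < Pn th X * A X h
       then Pn th X * A X h * ln (A X h / out_marg A th h)
       else 0).

(* mem_n(P, alpha) = inf { mem_n(A, P) : err(A, P) <= alpha }  (in \bar R,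
   so that the infimum of the empty set is +oo) *)
Definition memP (n : nat) (nu alpha : R) : \bar R :=
  ereal_inf [set (memA nu A)%:E | A in [set A : algorithm n | is_alg A /\ err nu A <= alpha]].

End SparseBoolean.

(* Main.v *)
(** Lower bound.  Let [h] be the output and [v] a fresh point of [P_theta].  Since [v] is
    uniform once [theta] is averaged out, [h] tests the joint law of [(h, v)] against the
    product of its marginals, so [I(h; v) >= - ln (1 - (1 - 2 alpha)^2)] by
    Bretagnolle-Huber.  The channel from the samples to [v] is a product over the
    coordinates; on one coordinate it biases [v] by at most [nu 2^n], so by a Pinsker
    argument it contracts relative entropy by a factor [O(nu^2 2^(2n))], and this factor
    tensorises.  Finally [I(h; X | theta) >= I(h; X) - H(theta)] with
    [H(theta) = O(sqrt d log d)].

    Upper bound.  Keep each coordinate on which all samples agree with probability [2^-n]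
    and threshold the agreement of a new point with the kept values.  The planted
    coordinates contribute a mean [d nu 2^-n = C 2^-n sqrt d] to this agreement, against
    fluctuations of order [2^-n sqrt d].  About [d 2^(1-2n)] coordinates outside [S] are
    kept, at a cost of at most [n ln 2] nats each. *)

Require Import Defs.
From HB Require Import structures.
From mathcomp Require Import all_boot all_order all_algebra.
From mathcomp Require Import all_classical all_reals.
From mathcomp Require Import ereal sequences exp.
From mathcomp Require Import ring lra.
Set Implicit Arguments. Unset Strict Implicit. Unset Printing Implicit Defensive.
Import Order.TTheory GRing.Theory Num.Theory.
Local Open Scope ring_scope.

(** * Relative entropy and its contraction by product channels *)

Section RelativeEntropy.
Variable R : realType.

Lemma ln_le_subr1 (x : R) : 0 < x -> ln x <= x - 1.
Proof.
move=> x0; have := @le_ln1Dx R (x - 1).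
by have -> : 1 + (x - 1) = x by [ring]; apply; lra.
Qed.

Lemma ln_ge_subV1 (x : R) : 0 < x -> 1 - x^-1 <= ln x.
Proof.
move=> x0; have := @ln_le_subr1 x^-1; rewrite invr_gt0 => /(_ x0).
by rewrite lnV ?posrE//; lra.
Qed.

(** The tangent bound [ln z >= 1 - z^-1] is used termwise at [z = a i / b i / r], where [r] is the
    ratio of the two totals. *)
Lemma log_sum (I : finType) (P : pred I) (a b : I -> R) :
  (forall i, P i -> 0 <= a i) -> (forall i, P i -> 0 <= b i) ->
  (forall i, P i -> 0 < a i -> 0 < b i) ->
  (\sum_(i | P i) a i) * ln ((\sum_(i | P i) a i) / \sum_(i | P i) b i)
    <= \sum_(i | P i) a i * ln (a i / b i).
Proof.
move=> a0 b0 ab.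
set A := \sum_(i | P i) a i; set B := \sum_(i | P i) b i.
have A0 : 0 <= A by apply: sumr_ge0.
have [/(psumr_eq0P a0) A_eq0|A_neq0] := eqVneq A 0.
  by rewrite /A !big1 ?mul0r// => i Pi; rewrite A_eq0// mul0r.
have A_gt0 : 0 < A by rewrite lt_neqAle eq_sym A_neq0.
have B_gt0 : 0 < B.
  have [i /andP[Pi ai]] : exists i, P i && (0 < a i).
    apply/existsP; apply: contraT => /existsPn H; move: A_neq0.
    rewrite /A big1 ?eqxx// => i Pi; have := H i; rewrite Pi/= -leNgt => ai.
    by apply/eqP; rewrite eq_le ai a0.
  rewrite /B (bigD1 i)//= ltr_pwDl ?ab//.
  by apply: sumr_ge0 => j /andP[Pj _]; exact: b0.
set r := A / B.
have r0 : 0 < r by rewrite divr_gt0.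
(* The added terms [a i - r * b i] sum to [A - r * B = 0], so the inequality can be checked term by
   term. *)
have -> : A * ln r = \sum_(i | P i) (a i * ln r + a i - r * b i).
  rewrite big_split big_split/= -mulr_suml -/A sumrN -mulr_sumr -/B.
  by rewrite /r divfK ?gt_eqF// addrK.
apply: ler_sum => i Pi.
have := a0 _ Pi; rewrite le_eqVlt => /predU1P[<-|ai].
  by rewrite !mul0r !add0r oppr_le0 mulr_ge0 ?b0// ltW.
have bi := ab _ Pi ai.
have := @ln_ge_subV1 (a i / b i / r).
rewrite !divr_gt0// => /(_ isT).
rewrite ln_div ?posrE ?divr_gt0// invf_div => H.
have : a i * (1 - r / (a i / b i)) <= a i * (ln (a i / b i) - ln r) by rewrite ler_pM2l.
have -> : a i * (1 - r / (a i / b i)) = a i - r * b i by field; rewrite !gt_eqF.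
lra.
Qed.

(* [q] need not be normalised: [relent q p = |q| KL(q / |q| || p)], homogeneous of degree 1. *)
Definition relent (T : finType) (q p : T -> R) : R :=
  \sum_x q x * ln (q x / (p x * \sum_y q y)).

Definition push (T B : finType) (K : T -> B -> R) (q : T -> R) (b : B) : R :=
  \sum_x q x * K x b.

(** A strong data-processing inequality. It is demanded of every nonnegative [q], normalised or not,
    so that it applies to the slice of a joint law at a fixed output [h]. *)
Definition contracts (T B : finType) (p : T -> R) (K : T -> B -> R) (rho : R) :=
  forall q : T -> R, (forall x, 0 <= q x) ->
    relent (push K q) (push K p) <= rho * relent q p.

Lemma sum_pair (S T : finType) (F : S * T -> R) :
  \sum_z F z = \sum_x \sum_y F (x, y).
Proof. by rewrite pair_bigA; apply: eq_bigr => -[]. Qed.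

(** Convexity in the first argument, from the log-sum inequality at each point [x]. Homogeneity of
    [relent] lets the weights [c] have any total. *)
Lemma relent_mix (I T : finType) (c : I -> R) (q : I -> T -> R) (p : T -> R) :
  (forall i, 0 <= c i) -> (forall i x, 0 <= q i x) -> (forall x, 0 < p x) ->
  relent (fun x => \sum_i c i * q i x) p <= \sum_i c i * relent (q i) p.
Proof.
move=> c0 q0 p0.
have cq0 i x : 0 <= c i * q i x by exact: mulr_ge0.
rewrite /relent; under [leRHS]eq_bigr do rewrite big_distrr/=.
rewrite [leRHS]exchange_big/=; apply: ler_sum => x _.
have -> : p x * \sum_y \sum_i c i * q i y = \sum_i c i * (p x * \sum_y q i y).
  rewrite exchange_big big_distrr/=; apply: eq_bigr => i _.
  by rewrite -big_distrr/= mulrCA.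
apply: le_trans (log_sum (b := fun i => c i * (p x * \sum_y q i y)) _ _ _) _.
- by [].
- by move=> i _; rewrite mulr_ge0// mulr_ge0 ?sumr_ge0// ltW.
- move=> i _; rewrite lt_neqAle eq_sym mulf_eq0 negb_or => /andP[/andP[ci qi] _].
  rewrite mulr_gt0//; first by rewrite lt_neqAle eq_sym ci c0.
  rewrite mulr_gt0//.
  rewrite (bigD1 x)//= ltr_pwDl ?sumr_ge0//.
  by rewrite lt_neqAle eq_sym qi q0.
apply: ler_sum => i _.
have [->|ci] := eqVneq (c i) 0; first by rewrite !mul0r.
by rewrite -mulf_div divff// mul1r mulrA.
Qed.

(** The chain rule. Leaving the slices [q (x, _)] unnormalised absorbs the usual weights of the
    conditional terms. *)
Lemma relent_chain (S T : finType) (q : S * T -> R) (p1 : S -> R) (p2 : T -> R) :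
  (forall z, 0 <= q z) -> (forall x, 0 < p1 x) -> (forall y, 0 < p2 y) ->
  relent q (fun z => p1 z.1 * p2 z.2) =
  relent (fun x => \sum_y q (x, y)) p1 + \sum_x relent (fun y => q (x, y)) p2.
Proof.
move=> q0 p10 p20.
rewrite /relent -big_split/= !sum_pair/=.
apply: eq_bigr => x _; rewrite big_distrl/= -big_split/=.
apply: eq_bigr => y _; have [->|qxy] := eqVneq (q (x, y)) 0.
  by rewrite !mul0r addr0.
have q_gt0 : 0 < q (x, y) by rewrite lt_neqAle eq_sym qxy q0.
have s_ge0 x' : 0 <= \sum_y0 q (x', y0) by apply: sumr_ge0.
have qx_gt0 : 0 < \sum_y0 q (x, y0).
  by rewrite (bigD1 y)//= ltr_pwDl// sumr_ge0.
have m_gt0 : 0 < \sum_x0 \sum_y0 q (x0, y0).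
  by rewrite (bigD1 x)//= ltr_pwDl// sumr_ge0.
rewrite -mulrDr -lnM ?posrE ?divr_gt0 ?mulr_gt0//.
by congr (_ * ln _); field; rewrite !gt_eqF ?p10 ?p20.
Qed.

Lemma push_ge0 (T B : finType) (K : T -> B -> R) (q : T -> R) :
  (forall x b, 0 <= K x b) -> (forall x, 0 <= q x) -> forall b, 0 <= push K q b.
Proof. by move=> K0 q0 b; apply: sumr_ge0 => x _; rewrite mulr_ge0. Qed.

Lemma push_prod (S T A B : finType) (K1 : S -> A -> R) (K2 : T -> B -> R) p1 p2 ab :
  push (fun z ab => K1 z.1 ab.1 * K2 z.2 ab.2) (fun z => p1 z.1 * p2 z.2) ab
  = push K1 p1 ab.1 * push K2 p2 ab.2.
Proof.
rewrite /push sum_pair/=.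
rewrite big_distrl/=; apply: eq_bigr => x _; rewrite big_distrr/=.
by apply: eq_bigr => y _; ring.
Qed.

(** The chain rule splits the output entropy. The first output marginal is [K1] applied to the first
    marginal of [q], since [K2] is stochastic. Fixing the first output leaves [K2] applied to a
    mixture of slices of [q], and convexity leads back to the slices themselves. *)
Lemma contracts_prod (S T A B : finType) (K1 : S -> A -> R) (K2 : T -> B -> R)
    (p1 : S -> R) (p2 : T -> R) (rho : R) :
  (forall x a, 0 <= K1 x a) -> (forall y b, 0 <= K2 y b) ->
  (forall x, \sum_a K1 x a = 1) -> (forall y, \sum_b K2 y b = 1) ->
  (forall x, 0 < p1 x) -> (forall y, 0 < p2 y) ->
  (forall a, 0 < push K1 p1 a) -> (forall b, 0 < push K2 p2 b) ->
  contracts p1 K1 rho -> contracts p2 K2 rho -> 0 <= rho ->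
  contracts (fun z => p1 z.1 * p2 z.2)
    (fun z ab => K1 z.1 ab.1 * K2 z.2 ab.2) rho.
Proof.
move=> K10 K20 K11 K21 p10 p20 k10 k20 C1 C2 rho0 q q0.
rewrite (funext (push_prod K1 K2 p1 p2)).
rewrite !relent_chain//; last first.
  by apply: push_ge0 => // z ab; rewrite mulr_ge0.
rewrite mulrDr lerD//.
  have -> : (fun a => \sum_b push (fun z ab => K1 z.1 ab.1 * K2 z.2 ab.2) q (a, b))
      = push K1 (fun x => \sum_y q (x, y)).
    apply/funext => a; rewrite /push exchange_big/= sum_pair.
    apply: eq_bigr => x _; rewrite big_distrl/=; apply: eq_bigr => y _.
    by rewrite -big_distrr/= -big_distrr/= K21 mulr1.
  by apply: C1 => x; exact: sumr_ge0.
(* [r a] is the law of the second input jointly with first output [a]: the slices [q (x, _)] mixed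
   with weights [K1 x a]. *)
pose r a y := \sum_x K1 x a * q (x, y).
have r0 a y : 0 <= r a y by apply: sumr_ge0 => x _; rewrite mulr_ge0.
apply: (@le_trans _ _ (\sum_a rho * relent (r a) p2)).
  apply: ler_sum => a _.
  have -> : (fun b => push (fun z ab => K1 z.1 ab.1 * K2 z.2 ab.2) q (a, b))
      = push K2 (r a).
    apply/funext => b; rewrite /push sum_pair exchange_big/=.
    apply: eq_bigr => y _; rewrite /r big_distrl/=.
    by apply: eq_bigr => x _; ring.
  exact: C2.
rewrite -big_distrr ler_wpM2l//=.
apply: (@le_trans _ _ (\sum_a \sum_x K1 x a * relent (fun y => q (x, y)) p2)).
  by apply: ler_sum => a _; exact: relent_mix.
rewrite exchange_big/=; apply: ler_sum => x _.
by rewrite -big_distrl/= K11 mul1r.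
Qed.

Lemma relent_bij (S T : finType) (f : S -> T) (q p : T -> R) :
  bijective f -> relent q p = relent (q \o f) (p \o f).
Proof.
move=> fb; have fb' : {on [pred x | true], bijective f} by exact: onW_bij.
rewrite /relent (reindex f)//=; apply: eq_bigr => x _.
by rewrite [in LHS](reindex f).
Qed.

Lemma contracts_bij (S T A B : finType) (f : S -> T) (g : A -> B)
    (K : T -> B -> R) (p : T -> R) (rho : R) :
  bijective f -> bijective g ->
  contracts (p \o f) (fun x a => K (f x) (g a)) rho -> contracts p K rho.
Proof.
move=> fb gb H q q0.
have E r : push K r \o g = push (fun x a => K (f x) (g a)) (r \o f).
  by apply/funext => a; rewrite /push/= (reindex f)//; exact: onW_bij.
rewrite (relent_bij _ _ gb) (relent_bij _ _ fb) !E.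
by apply: H => x; exact: q0.
Qed.

(** * Tensorisation over the coordinates *)

Definition ffun_cons (T : finType) d (z : T * {ffun 'I_d -> T}) : {ffun 'I_d.+1 -> T} :=
  [ffun i => oapp z.2 z.1 (unlift ord0 i)].

Lemma ffun_consE0 (T : finType) d (z : T * {ffun 'I_d -> T}) : ffun_cons z ord0 = z.1.
Proof. by rewrite ffunE unlift_none. Qed.

Lemma ffun_consES (T : finType) d (z : T * {ffun 'I_d -> T}) i :
  ffun_cons z (lift ord0 i) = z.2 i.
Proof. by rewrite ffunE liftK. Qed.

Lemma ffun_cons_bij (T : finType) d : bijective (@ffun_cons T d).
Proof.
exists (fun f : {ffun 'I_d.+1 -> T} => (f ord0, [ffun i : 'I_d => f (lift ord0 i)])).
  move=> [x f]; rewrite ffun_consE0; congr (_, _).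
  by apply/ffunP => i; rewrite ffunE ffun_consES.
move=> f; apply/ffunP => i; rewrite ffunE/=.
by case: unliftP => [j ->|->]//=; rewrite ffunE.
Qed.

Lemma sum_ffun_prod (T : finType) d (F : 'I_d -> T -> R) :
  \sum_(f : {ffun 'I_d -> T}) \prod_i F i (f i) = \prod_i \sum_x F i x.
Proof. by rewrite bigA_distr_bigA. Qed.

(** Induction on [d], splitting off one coordinate with [ffun_cons]. The factor [rho] is the same at
    every [d] because [contracts_prod] preserves it. *)
Lemma contracts_ffun (T B : finType) (K : T -> B -> R) (p : T -> R) (rho : R) d :
  (forall x b, 0 <= K x b) -> (forall x, \sum_b K x b = 1) ->
  (forall x, 0 < p x) -> (forall b, 0 < push K p b) ->
  contracts p K rho -> 0 <= rho ->
  contracts (fun f : {ffun 'I_d -> T} => \prod_i p (f i))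
    (fun (f : {ffun 'I_d -> T}) (g : {ffun 'I_d -> B}) => \prod_i K (f i) (g i)) rho.
Proof.
move=> K0 K1 p0 k0 C rho0; elim: d => [|d IH].
  (* For [d = 0] both spaces are a single point, where relative entropy vanishes. *)
  move=> q q0; rewrite /relent.
  have E (S : finType) (F : {ffun 'I_0 -> S} -> R) : 
     (forall f, 0 <= F f) -> \sum_x F x * ln (F x / ((fun=> 1) x * \sum_y F y)) = 0.
    move=> F0; have S1 (G : {ffun 'I_0 -> S} -> R) : \sum_x G x = G (ffun0 (card_ord 0)).
      rewrite (bigD1 (ffun0 (card_ord 0)))//= big1 ?addr0// => i.
      by case/eqP; apply/ffunP; case.
    rewrite !S1 mul1r; have [->|Fn] := eqVneq (F (ffun0 (card_ord 0))) 0.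
      by rewrite mul0r.
    by rewrite divff// ln1 mulr0.
  have P1 (S : finType) (G : S -> R) (f : {ffun 'I_0 -> S}) : \prod_i G (f i) = 1.
    by rewrite big_ord0.
  rewrite (_ : \sum_x q x * _ = 0) ?mulr0; last first.
    by under eq_bigr do rewrite P1; exact: E.
  pose Kp (f : {ffun 'I_0 -> T}) (g : {ffun 'I_0 -> B}) := \prod_i K (f i) (g i).
  rewrite (eq_bigr (fun x => push Kp q x *
     ln (push Kp q x / ((fun=> 1) x * \sum_y push Kp q y)))).
    rewrite E// => f; apply: push_ge0 => // x b; exact: prodr_ge0.
  move=> x _; congr (_ * ln (_ / (_ * _))).
  rewrite {1}/push; under eq_bigr do rewrite -big_split/=.
  by rewrite (sum_ffun_prod (fun i t => p t * K t (x i))) big_ord0.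
apply: (contracts_bij (ffun_cons_bij T d) (ffun_cons_bij B d)).
have -> : (fun f : {ffun 'I_d.+1 -> T} => \prod_i p (f i)) \o @ffun_cons T d =
    (fun z => p z.1 * (fun f : {ffun 'I_d -> T} => \prod_i p (f i)) z.2).
  apply/funext => z/=; rewrite big_ord_recl ffun_consE0; congr (_ * _).
  by apply: eq_bigr => i _; rewrite ffun_consES.
have -> : (fun x a => \prod_i K (ffun_cons x i) (ffun_cons a i)) =
    (fun (z : T * {ffun 'I_d -> T}) (b : B * {ffun 'I_d -> B}) => K z.1 b.1 *
     (fun (f : {ffun 'I_d -> T}) (g : {ffun 'I_d -> B}) => \prod_i K (f i) (g i)) z.2 b.2).
  apply/funext => z; apply/funext => b; rewrite big_ord_recl !ffun_consE0; congr (_ * _).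
  by apply: eq_bigr => i _; rewrite !ffun_consES.
apply: (@contracts_prod _ _ _ _ K
    (fun (f : {ffun 'I_d -> T}) (g : {ffun 'I_d -> B}) => \prod_i K (f i) (g i))
    p (fun f : {ffun 'I_d -> T} => \prod_i p (f i))) => //.
- by move=> f g; exact: prodr_ge0.
- by move=> f; rewrite (sum_ffun_prod (fun i => K (f i))) big1.
- by move=> f; exact: prodr_gt0.
- move=> g; rewrite /push; under eq_bigr do rewrite -big_split/=.
  rewrite (sum_ffun_prod (fun i t => p t * K t (g i))).
  by apply: prodr_gt0 => i _; exact: k0.
Qed.

End RelativeEntropy.
(** * Entropy inequalities *)

Section Inequalities.
Variable R : realType.

Lemma eq_ler (x y : R) : x = y -> x <= y.
Proof. by move->. Qed.

(** Invert [expR (- y) >= 1 - y] and use [(1 - y) * (1 + y + 2 * y ^+ 2) >= 1]. *)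
Lemma expR_le_quad (y : R) : y <= 1 / 2 -> expR y <= 1 + y + 2 * y ^+ 2.
Proof.
move=> y2; have := @expR_ge1Dx R (- y); rewrite expRN => H.
have y1 : 0 < 1 - y by lra.
apply: (@le_trans _ _ (1 - y)^-1).
  by rewrite -[leLHS]invrK lef_pV2 ?posrE ?invr_gt0 ?expR_gt0.
rewrite -[leRHS]mul1r -[X in X * _](mulVf (lt0r_neq0 y1)) -mulrA.
rewrite ler_peMr ?invr_ge0 ?(ltW y1)//.
have -> : (1 - y) * (1 + y + 2 * y ^+ 2) = 1 + y ^+ 2 * (1 - 2 * y) by ring.
by rewrite lerDl mulr_ge0 ?sqr_ge0//; lra.
Qed.

(* Donsker-Varadhan, linearised: [ln z >= 1 - 1/z] at [z = q / (p m e^f)], [m = |q|]. *)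
Lemma relent_ge_test (T : finType) (q p f : T -> R) :
  (forall x, 0 <= q x) -> (forall x, 0 < p x) ->
  \sum_x q x * f x - (\sum_x q x) * (\sum_x p x * expR (f x) - 1) <= relent q p.
Proof.
move=> q0 p0; set m := \sum_x q x.
have -> : \sum_x q x * f x - m * (\sum_x p x * expR (f x) - 1) =
    \sum_x (q x * f x - p x * m * expR (f x) + q x).
  rewrite big_split sumrB/= -/m.
  have -> : \sum_x p x * m * expR (f x) = m * \sum_x p x * expR (f x).
    by rewrite big_distrr/=; apply: eq_bigr => x _; ring.
  by ring.
apply: ler_sum => x _.
have m0 : 0 <= m by apply: sumr_ge0.
have [->|qx] := eqVneq (q x) 0.
  rewrite !mul0r addr0 sub0r oppr_le0.
  by rewrite !mulr_ge0// ?expR_ge0// ltW.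
have q_gt0 : 0 < q x by rewrite lt_neqAle eq_sym qx q0.
have m_gt0 : 0 < m by rewrite /m (bigD1 x)//= ltr_pwDl// sumr_ge0.
have := @ln_ge_subV1 R (q x / (p x * m) / expR (f x)).
rewrite !divr_gt0 ?mulr_gt0 ?expR_gt0// => /(_ isT).
rewrite ln_div ?posrE ?divr_gt0 ?mulr_gt0 ?expR_gt0// expRK => H; move: H.
move=> /(ler_wpM2l (ltW q_gt0)).
have -> : q x * (1 - (q x / (p x * m) / expR (f x))^-1) =
   q x - p x * m * expR (f x).
  by field; rewrite !gt_eqF ?expR_gt0 ?p0.
lra.
Qed.

Lemma sum_bool (F : bool -> R) : \sum_b F b = F true + F false.
Proof. by rewrite big_bool. Qed.

Definition sgn (b : bool) : R := if b then 1 else -1.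

(** Both entropies are compared with [s ^+ 2 / m], where [m] is the mass of [q] and [s] its
    [be]-moment. Centring makes the image of [p] uniform, and the output entropy is then at most the
    chi-square quantity [s ^+ 2 / m]. Testing [q] against a multiple of [be] bounds the input
    entropy below by [s ^+ 2 / (8 * m * tau ^+ 2)]. *)
Lemma contracts_bias (T : finType) (p be : T -> R) (tau : R) :
  (forall x, 0 < p x) -> \sum_x p x = 1 -> 0 < tau -> tau <= 1 ->
  (forall x, `|be x| <= tau) -> \sum_x p x * be x = 0 ->
  contracts p (fun x v => (1 + sgn v * be x) / 2) (8 * tau ^+ 2).
Proof.
move=> p0 p1 t0 t1 bt pb q q0.
set K := fun x v => _; set m := \sum_x q x; set s := \sum_x q x * be x.
have pK : push K p = fun=> 2^-1.
  apply/funext => v; rewrite /push.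
  have -> : \sum_x p x * K x v = (\sum_x p x + sgn v * \sum_x p x * be x) / 2.
    rewrite big_distrr/= -big_split/= big_distrl/=.
    by apply: eq_bigr => x _; rewrite /K; ring.
  by rewrite pb p1; field.
have qK v : push K q v = (m + sgn v * s) / 2.
  rewrite /push /m /s big_distrr/= -big_split/= big_distrl/=.
  by apply: eq_bigr => x _; rewrite /K; ring.
have m0 : 0 <= m by apply: sumr_ge0.
have [m_eq0|m_neq0] := eqVneq m 0.
  have qx0 x : q x = 0 by apply: (psumr_eq0P _ m_eq0).
  rewrite /relent big1; last first.
    by move=> v _; rewrite /push big1 ?mul0r// => x _; rewrite qx0 mul0r.
  by rewrite big1 ?mulr0// => x _; rewrite qx0 mul0r.
have m_gt0 : 0 < m by rewrite lt_neqAle eq_sym m_neq0.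
have s_le : `|s| <= tau * m.
  apply: (le_trans (ler_norm_sum _ _ _)); rewrite /m big_distrr/=.
  by apply: ler_sum => x _; rewrite normrM (ger0_norm (q0 x)) mulrC ler_wpM2r.
have L1 : relent (push K q) (push K p) <= s ^+ 2 / m.
  have Km : \sum_v push K q v = m by rewrite sum_bool !qK /sgn; field.
  rewrite /relent Km pK.
  (* The bound is [ln z <= z - 1] at [z = 1 + sgn v * s / m]. *)
  apply: (@le_trans _ _ (\sum_v (m + sgn v * s) / 2 * (sgn v * s / m))); last first.
    by rewrite sum_bool /sgn; apply: eq_ler; field; rewrite gt_eqF.
  have qK0 v : 0 <= push K q v.
    rewrite qK divr_ge0//.
    have : `|s| <= m by apply: le_trans s_le _; rewrite ler_piMl.
    by rewrite ler_norml => /andP[]; rewrite /sgn; case: v; lra.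
  apply: ler_sum => v _; rewrite -qK.
  have := qK0 v; rewrite le_eqVlt => /predU1P[<-|qv]; first by rewrite !mul0r.
  rewrite ler_wpM2l//; apply: le_trans (ln_le_subr1 _) _.
    by rewrite divr_gt0 ?mulr_gt0.
  by rewrite qK; apply: eq_ler; field; rewrite gt_eqF.
have L2 : s ^+ 2 / (8 * m * tau ^+ 2) <= relent q p.
  (* The maximiser of [l * s - 2 * m * l ^+ 2 * tau ^+ 2]. It keeps [l * be x] at most 1/4 in
     absolute value, within the range of [expR_le_quad]. *)
  pose l := s / (4 * m * tau ^+ 2).
  apply: le_trans (@relent_ge_test _ q p (fun x => l * be x) q0 p0).
  have lt x : l * be x <= 1 / 2.
    apply: le_trans (ler_norm _) _; rewrite normrM.
    apply: (@le_trans _ _ (tau * m / (4 * m * tau ^+ 2) * tau)).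
      have D0 : 0 <= (4 * m * tau ^+ 2)^-1 by rewrite invr_ge0 ?mulr_ge0 ?exprn_ge0 ?ltW.
      by rewrite ler_pM// /l normrM (ger0_norm D0) ler_wpM2r.
    have -> : tau * m / (4 * m * tau ^+ 2) * tau = 1 / 4.
      by field; rewrite !gt_eqF.
    lra.
  have E : \sum_x p x * expR (l * be x) - 1 <= 2 * l ^+ 2 * tau ^+ 2.
    apply: (@le_trans _ _ (\sum_x (p x * (1 + 2 * l ^+ 2 * tau ^+ 2) + l * (p x * be x)) - 1)).
      rewrite lerD2r; apply: ler_sum => x _.
      have : p x * expR (l * be x) <= p x * (1 + l * be x + 2 * (l * be x) ^+ 2).
        by rewrite ler_wpM2l ?expR_le_quad// ltW.
      have : p x * (2 * (l * be x) ^+ 2) <= p x * (2 * l ^+ 2 * tau ^+ 2).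
        have bt2 : be x ^+ 2 <= tau ^+ 2.
          by rewrite -[be x ^+ 2]real_normK ?num_real// ler_sqr ?nnegrE ?(ltW t0) ?normr_ge0.
        rewrite ler_wpM2l ?(ltW (p0 x))// exprMn mulrA; apply: ler_wpM2l => //.
        by rewrite mulr_ge0// sqr_ge0.
      lra.
    rewrite big_split/= -!big_distrl/= -big_distrr/= p1 pb; lra.
  have -> : \sum_x q x * (l * be x) = l * s.
    by rewrite /s big_distrr/=; apply: eq_bigr => x _; ring.
  apply: (@le_trans _ _ (l * s - m * (2 * l ^+ 2 * tau ^+ 2))).
    by apply: eq_ler; rewrite /l; field; rewrite !gt_eqF.
  by rewrite lerB// ler_wpM2l.
apply: (le_trans L1).
have -> : s ^+ 2 / m = 8 * tau ^+ 2 * (s ^+ 2 / (8 * m * tau ^+ 2)).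
  by field; rewrite !gt_eqF.
by rewrite ler_wpM2l// mulr_ge0// sqr_ge0.
Qed.

(* With [a, b, c, e] the square roots of [P, Q, 1 - P, 1 - Q], Lagrange's identity gives
   [1 - (a b + c e)^2 = (a e - b c)^2] and [P - Q = (a e - b c) (a e + b c)]. *)
Lemma bretagnolle_huber (P Q de : R) :
  0 < Q -> 0 < de -> Q + de <= P -> P <= 1 ->
  - ln (1 - de ^+ 2) <= P * ln (P / Q) + (1 - P) * ln ((1 - P) / (1 - Q)).
Proof.
move=> Q0 de0 QP P1.
have P0 : 0 < P by lra.
have Q1 : Q < 1 by lra.
pose a := Num.sqrt P; pose b := Num.sqrt Q.
pose c := Num.sqrt (1 - P); pose e := Num.sqrt (1 - Q).
have a2 : a ^+ 2 = P by rewrite sqr_sqrtr// ltW.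
have b2 : b ^+ 2 = Q by rewrite sqr_sqrtr// ltW.
have c2 : c ^+ 2 = 1 - P by rewrite sqr_sqrtr//; lra.
have e2 : e ^+ 2 = 1 - Q by rewrite sqr_sqrtr//; lra.
have a0 : 0 < a by rewrite sqrtr_gt0.
have b0 : 0 < b by rewrite sqrtr_gt0.
have c0 : 0 <= c by rewrite sqrtr_ge0.
have e0 : 0 < e by rewrite sqrtr_gt0; lra.
pose z := a * b + c * e.
have z0 : 0 < z by rewrite ltr_wpDr ?mulr_gt0// mulr_ge0// ltW.
have z2 : z ^+ 2 <= 1 - de ^+ 2.
  have E1 : 1 - z ^+ 2 = (a * e - b * c) ^+ 2.
    have -> : 1 = (a ^+ 2 + c ^+ 2) * (b ^+ 2 + e ^+ 2) by rewrite a2 b2 c2 e2; ring.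
    by rewrite /z; ring.
  have E2 : P - Q = (a * e - b * c) * (a * e + b * c).
    have -> : P - Q = a ^+ 2 * (b ^+ 2 + e ^+ 2) - b ^+ 2 * (a ^+ 2 + c ^+ 2).
      by rewrite a2 b2 c2 e2; ring.
    ring.
  have E3 : (a * e + b * c) ^+ 2 <= 1.
    have : (a * e + b * c) ^+ 2 + (a * b - c * e) ^+ 2 =
        (a ^+ 2 + c ^+ 2) * (b ^+ 2 + e ^+ 2) by ring.
    rewrite a2 b2 c2 e2.
    have : 0 <= (a * b - c * e) ^+ 2 by exact: sqr_ge0.
    lra.
  have E4 : de ^+ 2 <= (P - Q) ^+ 2 by rewrite ler_sqr ?nnegrE; lra.
  have E5 : (P - Q) ^+ 2 <= (a * e - b * c) ^+ 2.
    by rewrite E2 exprMn ler_piMr ?sqr_ge0.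
  lra.
have lnz : 2 * ln z <= ln (1 - de ^+ 2).
  rewrite mulr_natl -lnXn// ler_ln ?posrE// ?exprn_gt0//.
  by rewrite (lt_le_trans _ z2)// exprn_gt0.
(* The tangent of [ln] is taken for [x / y * z]. Since [a * b + c * e = z], the linear terms of the
   two uses cancel and only [- (2 * ln z)] remains. *)
have tangent (x y : R) : 0 < x -> 0 <= y ->
    x ^+ 2 * (- (2 * ln z) + 2) - 2 * x * y / z <= x ^+ 2 * ln (x ^+ 2 / y ^+ 2) \/ y = 0.
  move=> x0; rewrite le_eqVlt => /predU1P[|y0]; [by right|left].
  have -> : x ^+ 2 / y ^+ 2 = (x / y) ^+ 2 by rewrite expr_div_n.
  rewrite lnXn ?divr_gt0// -[ln (x / y) *+ 2]mulr_natl.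
  have := @ln_ge_subV1 R (x / y * z); rewrite !mulr_gt0 ?invr_gt0// => /(_ isT).
  rewrite lnM ?posrE ?divr_gt0// => H.
  have {}H := ler_wpM2l (sqr_ge0 x) H.
  have E : x ^+ 2 * (1 - (x / y * z)^-1) = x ^+ 2 - x * y / z.
    by field; rewrite !gt_eqF.
  rewrite E in H; lra.
have T1 : P * (- (2 * ln z) + 2) - 2 * a * b / z <= P * ln (P / Q).
  by have := tangent a b a0 (ltW b0); rewrite a2 b2 => -[//|b_eq0]; rewrite b_eq0 ltxx in b0.
have T2 : (1 - P) * (- (2 * ln z) + 2) - 2 * c * e / z <= (1 - P) * ln ((1 - P) / (1 - Q)).
  have := c0; rewrite le_eqVlt => /predU1P[c_eq0|c_gt0].
    by have := c2; rewrite -c_eq0 expr0n/= => <-; rewrite !mul0r mulr0 !mul0r subr0.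
  by have := tangent c e c_gt0 (ltW e0); rewrite c2 e2 => -[//|e_eq0]; rewrite e_eq0 ltxx in e0.
have E : 2 * a * b / z + 2 * c * e / z = 2.
  have -> : 2 * a * b / z + 2 * c * e / z = 2 * ((a * b + c * e) / z) by ring.
  by rewrite -/z divff ?mulr1// gt_eqF.
lra.
Qed.

(** With [de = 1 - 2 * al], the log-odds equal [2 * ln (1 + de) - w], and the bounds
    [ln (1 + de) <= de] and [w <= - de ^+ 2] suffice. This puts the Bretagnolle-Huber bound in
    log-odds form at the price of a factor 4. *)
Lemma bretagnolle_huber_log_odds (al : R) : 0 < al -> al < 1 / 2 ->
  (1 - 2 * al) * ln ((1 - al) / al) <= 4 * - ln (1 - (1 - 2 * al) ^+ 2).
Proof.
move=> al0 al2.
have E : 1 - (1 - 2 * al) ^+ 2 = 4 * (al * (1 - al)) by ring.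
have b0 : 0 < 1 - al by lra.
have ab0 : 0 < al * (1 - al) by rewrite mulr_gt0.
set de := 1 - 2 * al; set w := ln (1 - de ^+ 2).
have w_le : w <= - de ^+ 2.
  have D0 : 0 < 1 - de ^+ 2 by rewrite E mulr_gt0.
  by have := ln_le_subr1 D0; rewrite -/w; lra.
have -> : ln ((1 - al) / al) = 2 * ln (2 * (1 - al)) - w.
  rewrite /w E [2 * ln _]mulr_natl -lnXn ?mulr_gt0//.
  rewrite -ln_div ?posrE ?exprn_gt0 ?mulr_gt0//.
  by congr ln; field; rewrite !gt_eqF.
have L : ln (2 * (1 - al)) <= de.
  have := @ln_le_subr1 R (2 * (1 - al)); rewrite mulr_gt0// => /(_ isT).
  by rewrite /de; lra.
have de0 : 0 < de by rewrite /de; lra.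
have H1 : de * ln (2 * (1 - al)) <= de * de by rewrite ler_wpM2l// ltW.
have H2 : (4 - de) * w <= (4 - de) * (- de ^+ 2) by rewrite ler_wpM2l//; rewrite /de; lra.
have H3 : 0 <= (1 - de) * (de ^+ 2) by rewrite mulr_ge0 ?sqr_ge0//; rewrite /de; lra.
have -> : de * (2 * ln (2 * (1 - al)) - w) = 2 * (de * ln (2 * (1 - al))) - de * w by ring.
have H4 : 0 <= de ^+ 2 by exact: sqr_ge0.
lra.
Qed.

(** Data processing through the indicator of [E]: the log-sum inequality on [E] and on its
    complement leaves a binary relative entropy, to which Bretagnolle-Huber applies. *)
Lemma sum_relent_ge_test (H V : finType) (r : H -> V -> R) (p : V -> R)
    (E : H -> V -> bool) (de : R) :
  (forall h v, 0 <= r h v) -> \sum_h \sum_v r h v = 1 ->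
  (forall v, 0 < p v) -> \sum_v p v = 1 -> 0 < de ->
  \sum_h (\sum_w r h w) * (\sum_(v | E h v) p v) + de <= \sum_h \sum_(v | E h v) r h v ->
  - ln (1 - de ^+ 2) <= \sum_h relent (r h) p.
Proof.
move=> r0 r1 p0 p1 de0.
pose m h := \sum_w r h w.
have m0 h : 0 <= m h by apply: sumr_ge0.
pose a (z : H * V) := r z.1 z.2; pose b (z : H * V) := p z.2 * m z.1.
have a0 z : 0 <= a z by exact: r0.
have b0 z : 0 <= b z by rewrite mulr_ge0// ltW.
have ab z : 0 < a z -> 0 < b z.
  move=> az; rewrite mulr_gt0// /m (bigD1 z.2)//= ltr_pwDl// sumr_ge0//.
set Q := \sum_h _ * _; set P := \sum_h _ => QP.
pose EE z := E z.1 z.2.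
have PE : P = \sum_(z | EE z) a z by rewrite /P pair_big_dep.
have QE : Q = \sum_(z | EE z) b z.
  rewrite /Q; under eq_bigr do rewrite big_distrr/=.
  by rewrite pair_big_dep/=; apply: eq_bigr => z _; rewrite /b mulrC.
have PC : 1 - P = \sum_(z | ~~ EE z) a z.
  have : \sum_z a z = 1 by rewrite sum_pair.
  rewrite (bigID EE)/= -PE; lra.
have QC : 1 - Q = \sum_(z | ~~ EE z) b z.
  have : \sum_z b z = 1.
    rewrite sum_pair/b/= -r1; apply: eq_bigr => h _.
    by rewrite -big_distrl/= p1 mul1r.
  rewrite (bigID EE)/= -QE; lra.
have P1 : P <= 1 by rewrite -subr_ge0 PC sumr_ge0.
have Q_ge0 : 0 <= Q by rewrite QE sumr_ge0.
(* If [Q] vanished, [r] would vanish on [E] as well, contradicting the gap [de]. *)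
have Q0 : 0 < Q.
  rewrite lt_neqAle Q_ge0 andbT; apply/negP => /eqP Q0.
  have P0 : P = 0.
    rewrite PE big1// => z zE; apply/eqP; rewrite eq_le a0 andbT leNgt.
    apply/negP => /ab; have := @psumr_eq0P _ _ EE b (fun z _ => b0 z).
    by rewrite -QE -Q0 => /(_ erefl _ zE) ->; rewrite ltxx.
  lra.
apply: (le_trans (bretagnolle_huber Q0 de0 QP P1)).
have -> : \sum_h relent (r h) p = \sum_z a z * ln (a z / b z) by rewrite sum_pair.
rewrite (bigID EE)/= PC QC PE QE.
by apply: lerD; apply: log_sum => // z _; exact: ab.
Qed.

Lemma sum_prod_marginal (I T : finType) (g : I -> T -> R) (psi : T -> R) (j : I) :
  (forall i, \sum_t g i t = 1) ->
  \sum_(f : {ffun I -> T}) (\prod_i g i (f i)) * psi (f j) = \sum_t g j t * psi t.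
Proof.
move=> g1.
transitivity (\sum_(f : {ffun I -> T}) \prod_i (g i (f i) * (if i == j then psi (f i) else 1))).
  apply: eq_bigr => f _; rewrite big_split/=; congr (_ * _).
  by rewrite -big_mkcond/= big_pred1_eq.
rewrite -(bigA_distr_bigA (fun i t => g i t * (if i == j then psi t else 1))).
rewrite (bigD1 j)//= eqxx [X in _ * X]big1 ?mulr1// => i /negPf ->.
by under eq_bigr do rewrite mulr1.
Qed.

Lemma ln_prod (I : finType) (F : I -> R) :
  (forall i, 0 < F i) -> ln (\prod_i F i) = \sum_i ln (F i).
Proof.
move=> F0; rewrite -[RHS]expRK expR_sum; congr ln.
by apply: eq_bigr => i _; rewrite lnK ?posrE.
Qed.

End Inequalities.
(** * Memorization lower bound *)

Section LowerBound.
Variable R : realType.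

Lemma sum_option_bool (F : option bool -> R) :
  \sum_t F t = F None + (F (Some true) + F (Some false)).
Proof.
rewrite (bigD1 None)//= (bigD1 (Some true))//= (bigD1 (Some false))//= big1 ?addr0//.
by move=> [[]|].
Qed.

(** * Single-coordinate laws and the columns of a sample *)

Definition coord_prior (nu : R) (t : option bool) : R :=
  match t with None => 1 - nu | Some _ => nu / 2 end.

Definition coord_lik (t : option bool) (b : bool) : R :=
  match t with None => 2^-1 | Some c => if b == c then 1 else 0 end.

Definition col_lik n (t : option bool) (u : {ffun 'I_n -> bool}) : R :=
  \prod_i coord_lik t (u i).

(** The sample matrix is read by columns because the columns are independent, both given [theta] and
    after averaging over it. *)
Definition col d n (X : samples d n) : {ffun 'I_d -> {ffun 'I_n -> bool}} :=
  [ffun j => [ffun i => X i j]].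

Definition uncol d n (U : {ffun 'I_d -> {ffun 'I_n -> bool}}) : samples d n :=
  [ffun i => [ffun j => U j i]].

Lemma uncolK d n : cancel (@uncol d n) (@col d n).
Proof. by move=> U; apply/ffunP => j; apply/ffunP => i; rewrite !ffunE. Qed.

Lemma colK d n : cancel (@col d n) (@uncol d n).
Proof. by move=> U; apply/ffunP => j; apply/ffunP => i; rewrite !ffunE. Qed.

Lemma uncol_bij d n : bijective (@uncol d n).
Proof. exact: Bijective (@uncolK d n) (@colK d n). Qed.

Lemma Pn_col d n (th : param d) (X : samples d n) :
  Pn R th X = \prod_j col_lik (th j) (col X j).
Proof.
rewrite /Pn /Ptheta exchange_big/=; apply: eq_bigr => j _.
by apply: eq_bigr => i _; rewrite !ffunE.
Qed.

Lemma sum_samples d n (F : 'I_d -> {ffun 'I_n -> bool} -> R) :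
  \sum_(X : samples d n) \prod_j F j (col X j) = \prod_j \sum_u F j u.
Proof.
rewrite (reindex (@uncol d n)); last exact/onW_bij/uncol_bij.
by under [LHS]eq_bigr do rewrite uncolK; rewrite bigA_distr_bigA.
Qed.

Lemma sum_coord_prior (nu : R) : \sum_t coord_prior nu t = 1.
Proof. by rewrite sum_option_bool/=; field. Qed.

Lemma sum_coord_lik t : \sum_b coord_lik t b = 1.
Proof.
by rewrite big_bool; case: t => [[]|]/=; rewrite ?addr0 ?add0r//; field.
Qed.

Lemma sum_col_lik n t : \sum_(u : {ffun 'I_n -> bool}) col_lik t u = 1.
Proof.
by rewrite (sum_ffun_prod (fun=> coord_lik t)) big1// => i _; exact: sum_coord_lik.
Qed.

Lemma coord_lik_ge0 t b : 0 <= coord_lik t b.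
Proof. by case: t => [c|]/=; [case: ifP|rewrite invr_ge0]. Qed.

Lemma col_lik_ge0 n t (u : {ffun 'I_n -> bool}) : 0 <= col_lik t u.
Proof. by apply: prodr_ge0 => i _; exact: coord_lik_ge0. Qed.

Lemma col_lik_None n (u : {ffun 'I_n -> bool}) : col_lik None u = 2^-1 ^+ n.
Proof. by rewrite /col_lik prodr_const card_ord. Qed.

Definition constb n (b : bool) (u : {ffun 'I_n -> bool}) : bool := [forall i, u i == b].

Lemma col_lik_Some n b (u : {ffun 'I_n -> bool}) : col_lik (Some b) u = (constb b u)%:R.
Proof.
rewrite /col_lik/=; case: (boolP (constb b u)) => [/forallP H|].
  by rewrite big1// => i _; rewrite H.
by rewrite negb_forall => /existsP[i /negPf H]; rewrite (bigD1 i)//= H mul0r.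
Qed.

Lemma sum_constb n b : \sum_(u : {ffun 'I_n -> bool}) (constb b u)%:R = 1 :> R.
Proof. by rewrite -[RHS](sum_col_lik n (Some b)); apply: eq_bigr => u _; rewrite col_lik_Some. Qed.

Lemma Pn_ge0 d n (th : param d) (X : samples d n) : 0 <= Pn R th X.
Proof. by rewrite Pn_col prodr_ge0// => j _; exact: col_lik_ge0. Qed.

Lemma sum_Pn d n (th : param d) : \sum_(X : samples d n) Pn R th X = 1.
Proof.
under [LHS]eq_bigr do rewrite Pn_col.
by rewrite (sum_samples (fun j => col_lik (th j))) big1// => j _; exact: sum_col_lik.
Qed.

Lemma sum_prior d (nu : R) : \sum_(th : param d) prior nu th = 1.
Proof.
by rewrite (sum_ffun_prod (fun=> coord_prior nu)) big1// => j _; exact: sum_coord_prior.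
Qed.

Lemma sum_Ptheta d (th : param d) : \sum_x Ptheta R th x = 1.
Proof.
by rewrite (sum_ffun_prod (fun j => coord_lik (th j))) big1// => j _; exact: sum_coord_lik.
Qed.

(** * Marginal law of a column and prediction of a fresh point *)

Definition col_marg nu n (u : {ffun 'I_n -> bool}) : R :=
  \sum_t coord_prior nu t * col_lik t u.

Lemma col_margE nu n (u : {ffun 'I_n -> bool}) :
  col_marg nu u = (1 - nu) * 2^-1 ^+ n
    + nu / 2 * ((constb true u)%:R + (constb false u)%:R).
Proof. by rewrite /col_marg sum_option_bool col_lik_None !col_lik_Some/=; ring. Qed.

(** The posterior mean of a fresh point's sign on a coordinate, given its column [u]. *)
Definition bias nu n (u : {ffun 'I_n -> bool}) : R :=
  nu / 2 * ((constb true u)%:R - (constb false u)%:R) / col_marg nu u.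

Definition next_ker nu n (u : {ffun 'I_n -> bool}) (v : bool) : R :=
  (1 + sgn R v * bias nu u) / 2.

Section Fixed.
Variable nu : R.
Hypothesis nu0 : 0 < nu.
Hypothesis nu1 : nu <= 1 / 2.

Lemma col_marg_ge n (u : {ffun 'I_n -> bool}) : 2^-1 * 2^-1 ^+ n <= col_marg nu u.
Proof.
have h0 : 0 <= 2^-1 ^+ n :> R by rewrite exprn_ge0// invr_ge0.
have H : 2^-1 * 2^-1 ^+ n <= (1 - nu) * 2^-1 ^+ n by rewrite ler_wpM2r//; move: nu1; lra.
rewrite col_margE (le_trans H)// lerDl mulr_ge0 ?divr_ge0 ?(ltW nu0)//.
Qed.

Lemma col_marg_gt0 n (u : {ffun 'I_n -> bool}) : 0 < col_marg nu u.
Proof. by rewrite (lt_le_trans _ (col_marg_ge u))// mulr_gt0 ?exprn_gt0 ?invr_gt0. Qed.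

Lemma sum_col_marg n : \sum_(u : {ffun 'I_n -> bool}) col_marg nu u = 1.
Proof.
rewrite exchange_big/= -[RHS](sum_coord_prior nu); apply: eq_bigr => t _.
by rewrite -big_distrr/= sum_col_lik mulr1.
Qed.

(** The numerator is at most [nu / 2], while unplanted coordinates alone give each column mass at
    least [2^-1 * 2^-1 ^+ n]. *)
Lemma bias_norm n (u : {ffun 'I_n -> bool}) : `|bias nu u| <= nu * 2 ^+ n.
Proof.
rewrite /bias normrM normfV (gtr0_norm (col_marg_gt0 u)) ler_pdivrMr ?col_marg_gt0// !normrM.
apply: (@le_trans _ _ (nu / 2)).
  rewrite normfV (gtr0_norm nu0) (@gtr0_norm _ 2)// ler_piMr ?divr_ge0 ?(ltW nu0)//.
  by do 2 case: (constb _ u); rewrite ?subrr ?subr0 ?sub0r ?normrN ?normr0 ?normr1.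
apply: (@le_trans _ _ (nu * 2 ^+ n * (2^-1 * 2^-1 ^+ n))).
  apply: eq_ler; rewrite exprVn; field.
  by rewrite expf_neq0.
by rewrite ler_wpM2l ?col_marg_ge// mulr_ge0 ?exprn_ge0// ltW.
Qed.

(** Bayes' rule with the denominator cleared: it identifies [next_ker] as the posterior predictive
    law. *)
Lemma next_kerE n (u : {ffun 'I_n -> bool}) v : (0 < n)%N ->
  col_marg nu u * next_ker nu u v
    = \sum_t coord_prior nu t * col_lik t u * coord_lik t v.
Proof.
move=> n0; rewrite /next_ker /bias sum_option_bool col_lik_None !col_lik_Some/=.
have -> : col_marg nu u * ((1 + sgn R v * (nu / 2 * ((constb true u)%:R -
    (constb false u)%:R) / col_marg nu u)) / 2) = col_marg nu u / 2 +
    sgn R v * nu / 4 * ((constb true u)%:R - (constb false u)%:R).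
  by field; rewrite gt_eqF ?col_marg_gt0.
by rewrite col_margE /sgn; case: v => /=; field.
Qed.

Lemma sum_prior_Pn d n (X : samples d n) :
  \sum_(th : param d) prior nu th * Pn R th X = \prod_j col_marg nu (col X j).
Proof.
under [LHS]eq_bigr do rewrite Pn_col -big_split/=.
by rewrite (sum_ffun_prod (fun j t => coord_prior nu t * col_lik t (col X j))).
Qed.

(** The prior is independent across coordinates, so averaging over [theta] leaves a product channel
    from the sample to a fresh point. *)
Lemma sum_prior_Pn_Ptheta d n (X : samples d n) (v : cube d) : (0 < n)%N ->
  \sum_(th : param d) prior nu th * Pn R th X * Ptheta R th v
    = (\prod_j col_marg nu (col X j)) * \prod_j next_ker nu (col X j) (v j).
Proof.
move=> n0; under [LHS]eq_bigr do rewrite Pn_col -!big_split/=.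
rewrite (sum_ffun_prod (fun j t => coord_prior nu t * col_lik t (col X j) * coord_lik t (v j))).
by rewrite -big_split/=; apply: eq_bigr => j _; rewrite next_kerE.
Qed.

Lemma sum_col_marg_bias n : \sum_(u : {ffun 'I_n -> bool}) col_marg nu u * bias nu u = 0.
Proof.
transitivity (\sum_(u : {ffun 'I_n -> bool})
    nu / 2 * ((constb true u)%:R - (constb false u)%:R)).
  by apply: eq_bigr => u _; rewrite /bias mulrC divfK// gt_eqF ?col_marg_gt0.
by rewrite -big_distrr/= sumrB !sum_constb subrr mulr0.
Qed.

Lemma sum_next_ker n (u : {ffun 'I_n -> bool}) : \sum_v next_ker nu u v = 1.
Proof. by rewrite sum_bool /next_ker /sgn; field. Qed.

Lemma push_next_ker n v : push (@next_ker nu n) (@col_marg nu n) v = 2^-1.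
Proof.
rewrite /push /next_ker.
have -> : \sum_(u : {ffun 'I_n -> bool}) col_marg nu u * ((1 + sgn R v * bias nu u) / 2) =
   (\sum_(u : {ffun 'I_n -> bool}) col_marg nu u +
    sgn R v * \sum_(u : {ffun 'I_n -> bool}) col_marg nu u * bias nu u) / 2.
  by rewrite big_distrr/= -big_split/= big_distrl/=; apply: eq_bigr => u _; ring.
by rewrite sum_col_marg sum_col_marg_bias mulr0 addr0 mul1r.
Qed.

Lemma next_ker_ge0 n (u : {ffun 'I_n -> bool}) v : nu * 2 ^+ n <= 1 -> 0 <= next_ker nu u v.
Proof.
move=> n1; rewrite divr_ge0//; have := le_trans (bias_norm u) n1.
by rewrite ler_norml => /andP[]; rewrite /sgn; case: v; lra.
Qed.

Definition next_ker_cube d n (X : samples d n) (v : cube d) : R :=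
  \prod_j next_ker nu (col X j) (v j).

Definition marg d n (X : samples d n) : R := \prod_j col_marg nu (col X j).

(** The one-coordinate bound [contracts_bias] at [tau = nu * 2 ^+ n], tensorised over the
    columns. *)
Lemma contracts_next_ker d n : nu * 2 ^+ n <= 1 ->
  contracts (@marg d n) (@next_ker_cube d n) (8 * (nu * 2 ^+ n) ^+ 2).
Proof.
move=> n1; apply: (contracts_bij (uncol_bij d n) (f := @uncol d n) (g := id)); first by exists id.
have -> : @marg d n \o @uncol d n = (fun U => \prod_j col_marg nu (U j)).
  by apply/funext => U; rewrite /marg/= uncolK.
have -> : (fun x a => next_ker_cube (@uncol d n x) a) =
    (fun (U : {ffun 'I_d -> {ffun 'I_n -> bool}}) (v : {ffun 'I_d -> bool}) =>
     \prod_j next_ker nu (U j) (v j)).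
  by apply/funext => U; apply/funext => v; rewrite /next_ker_cube uncolK.
apply: contracts_ffun.
- by move=> u v; exact: next_ker_ge0.
- exact: sum_next_ker.
- exact: col_marg_gt0.
- by move=> b; rewrite push_next_ker invr_gt0.
- apply: contracts_bias => //.
  + exact: col_marg_gt0.
  + exact: sum_col_marg.
  + by rewrite mulr_gt0 ?exprn_gt0.
  + exact: bias_norm.
  + exact: sum_col_marg_bias.
- by rewrite mulr_ge0 ?sqr_ge0.
Qed.

(** The sign is symmetric under the prior. Hence the null law is exactly the marginal of the fresh
    point, and false positives are measured by the product of the marginals of [h] and [v]. *)
Lemma push_next_ker_cube d n (v : cube d) :
  push (@next_ker_cube d n) (@marg d n) v = P0 R v.
Proof.
rewrite /push /marg /next_ker_cube; under [LHS]eq_bigr do rewrite -big_split/=.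
rewrite (sum_samples (fun j u => col_marg nu u * next_ker nu u (v j))).
by apply: eq_bigr => j _; exact: push_next_ker.
Qed.

(** * Memory, mutual information and the error *)

Lemma coord_prior_gt0 t : 0 < coord_prior nu t.
Proof. by case: t => [b|]/=; [rewrite divr_gt0|move: nu1; lra]. Qed.

Lemma prior_gt0 d (th : param d) : 0 < prior nu th.
Proof. by apply: prodr_gt0 => j _; exact: coord_prior_gt0. Qed.

Lemma marg_gt0 d n (X : samples d n) : 0 < marg X.
Proof. by apply: prodr_gt0 => j _; exact: col_marg_gt0. Qed.

(* [memA = I(h; X | theta) = I(h; X) - I(h; theta)] and [I(h; theta) <= H(theta)],
   because the output law [m] satisfies [m(h) >= prior(theta) m_theta(h)]. *)
Lemma memA_ge_mutual_info d n (A : algorithm R d n) : is_alg A ->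
  \sum_h relent (fun X => marg X * A X h) (@marg d n)
    + \sum_(th : param d) prior nu th * ln (prior nu th) <= memA nu A.
Proof.
move=> Aalg.
have A0 X h : 0 <= A X h by case: (Aalg X).
have A1 X : \sum_h A X h = 1 by case: (Aalg X).
pose m h := \sum_X marg X * A X h.
have mE h : m h = \sum_(th : param d) prior nu th * out_marg A th h.
  rewrite /m; under [LHS]eq_bigr do rewrite /marg -sum_prior_Pn big_distrl/=.
  rewrite exchange_big/=; apply: eq_bigr => th _; rewrite big_distrr/=.
  by apply: eq_bigr => X _; rewrite mulrA.
have out0 th h : 0 <= out_marg A th h by apply: sumr_ge0 => X _; rewrite mulr_ge0 ?Pn_ge0.
have -> : \sum_h relent (fun X => marg X * A X h) (@marg d n) =
    \sum_(th : param d) prior nu th * \sum_(X : samples d n) \sum_h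
      Pn R th X * A X h * ln (A X h / m h).
  under [RHS]eq_bigr do rewrite big_distrr/=.
  rewrite /relent exchange_big [RHS]exchange_big/=; apply: eq_bigr => X _.
  under [RHS]eq_bigr do rewrite big_distrr/=.
  rewrite [RHS]exchange_big/=; apply: eq_bigr => h _.
  under [RHS]eq_bigr do rewrite mulrA mulrA.
  rewrite -big_distrl/= -big_distrl/= sum_prior_Pn -/(marg X) -/(m h).
  by rewrite -mulf_div divff ?mul1r// gt_eqF ?marg_gt0.
have -> : \sum_(th : param d) prior nu th * ln (prior nu th) =
    \sum_(th : param d) prior nu th * \sum_(X : samples d n) \sum_h
      Pn R th X * A X h * ln (prior nu th).
  apply: eq_bigr => th _; congr (_ * _).
  under eq_bigr do rewrite -big_distrl/= -big_distrr/= A1 mulr1.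
  by rewrite -big_distrl/= sum_Pn mul1r.
rewrite -big_split/=; apply: ler_sum => th _.
rewrite -mulrDr ler_wpM2l ?(ltW (prior_gt0 _))// -big_split/=.
apply: ler_sum => X _; rewrite -big_split/=; apply: ler_sum => h _.
case: ifPn => [PA|]; last first.
  rewrite -leNgt => PA; have -> : Pn R th X * A X h = 0.
    by apply/eqP; rewrite eq_le PA mulr_ge0 ?Pn_ge0.
  by rewrite !mul0r addr0.
rewrite -mulrDr ler_wpM2l ?(ltW PA)//.
have P0 : 0 < Pn R th X.
  rewrite lt_neqAle Pn_ge0 andbT eq_sym; apply: contraTneq PA => ->.
  by rewrite mul0r ltxx.
have Ah : 0 < A X h by move: PA; rewrite pmulr_rgt0.
have oh : 0 < out_marg A th h.
  rewrite /out_marg (bigD1 X)//= ltr_pwDl// sumr_ge0// => Y _.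
  by rewrite mulr_ge0 ?Pn_ge0.
have pm : prior nu th * out_marg A th h <= m h.
  rewrite mE (bigD1 th)//= lerDl sumr_ge0// => th' _.
  by rewrite mulr_ge0// ltW ?prior_gt0.
have mh : 0 < m h by rewrite (lt_le_trans _ pm)// mulr_gt0 ?prior_gt0.
rewrite -lnM ?posrE ?divr_gt0 ?prior_gt0// ler_ln ?posrE ?mulr_gt0 ?divr_gt0 ?prior_gt0 ?invr_gt0//.
rewrite ler_pdivlMr//.
have -> : A X h / m h * prior nu th * out_marg A th h =
    A X h * (prior nu th * out_marg A th h / m h) by ring.
by rewrite ler_piMr ?(ltW Ah)// ler_pdivrMr// mul1r.
Qed.

(** This is minus the entropy of [theta], additive over its independent coordinates. *)
Lemma sum_prior_ln_prior d :
  \sum_(th : param d) prior nu th * ln (prior nu th)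
    = d%:R * ((1 - nu) * ln (1 - nu) + nu * ln (nu / 2)).
Proof.
transitivity (\sum_(th : param d) \sum_j
    (\prod_i coord_prior nu (th i)) * ln (coord_prior nu (th j))).
  apply: eq_bigr => th _.
  have -> : ln (prior nu th) = \sum_j ln (coord_prior nu (th j)).
    by apply: ln_prod => j; exact: coord_prior_gt0.
  by rewrite big_distrr.
rewrite exchange_big/=.
under eq_bigr => j _ do rewrite (sum_prod_marginal (fun t => ln (coord_prior nu t)) j
  (fun=> sum_coord_prior nu)).
rewrite sumr_const card_ord sum_option_bool/= [RHS]mulr_natl; congr (_ *+ _).
by field.
Qed.

(** The event that [h] accepts [v] separates the joint law of output and fresh point from the
    product of its marginals: the two probabilities differ by at least [1 - 2 * al]. *)
Lemma mutual_info_ge d n (A : algorithm R d n) al : (0 < n)%N -> is_alg A ->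
  nu * 2 ^+ n <= 1 -> err nu A <= al -> al < 1 / 2 ->
  - ln (1 - (1 - 2 * al) ^+ 2) <=
  \sum_h relent (push (@next_ker_cube d n) (fun X => marg X * A X h))
    (push (@next_ker_cube d n) (@marg d n)).
Proof.
move=> n0 Aalg n1 eA al2.
have A0 X h : 0 <= A X h by case: (Aalg X).
have A1 X : \sum_h A X h = 1 by case: (Aalg X).
have Kc0 (X : samples d n) (v : cube d) : 0 <= next_ker_cube X v.
  by apply: prodr_ge0 => j _; exact: next_ker_ge0.
pose r h := push (@next_ker_cube d n) (fun X => marg X * A X h).
(* Given [theta], the output [h] and the fresh point [v] are independent. *)
have rE h v : r h v = \sum_(th : param d) prior nu th *
     \sum_(X : samples d n) Pn R th X * (A X h * Ptheta R th v).
  under [RHS]eq_bigr do rewrite big_distrr/=.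
  rewrite [RHS]exchange_big/=; apply: eq_bigr => X _.
  rewrite mulrAC -sum_prior_Pn_Ptheta// big_distrl/=.
  by apply: eq_bigr => th _; ring.
have rsum (E : clf d -> pred (cube d)) : \sum_h \sum_(v | E h v) r h v =
    \sum_(th : param d) prior nu th * \sum_(X : samples d n) Pn R th X *
      \sum_h A X h * \sum_(v | E h v) Ptheta R th v.
  transitivity (\sum_h \sum_(th : param d) prior nu th *
     \sum_(X : samples d n) Pn R th X * (A X h * \sum_(v | E h v) Ptheta R th v)).
    apply: eq_bigr => h _; under eq_bigr do rewrite rE.
    rewrite exchange_big/=; apply: eq_bigr => th _.
    rewrite -big_distrr/= exchange_big/=; congr (_ * _); apply: eq_bigr => X _.
    by rewrite -big_distrr/= -big_distrr.
  rewrite exchange_big/=; apply: eq_bigr => th _.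
  rewrite -big_distrr/= exchange_big/=; congr (_ * _); apply: eq_bigr => X _.
  by rewrite -big_distrr.
have r_all : \sum_h \sum_v r h v = 1.
  rewrite (rsum (fun=> xpredT)); under eq_bigr do under eq_bigr do under eq_bigr do
    rewrite sum_Ptheta mulr1.
  under eq_bigr do under eq_bigr do rewrite A1 mulr1.
  by under eq_bigr do rewrite sum_Pn mulr1; exact: sum_prior.
have P00 v : 0 < P0 R v by apply: prodr_gt0 => j _; rewrite invr_gt0.
have P01 : \sum_(v : cube d) P0 R v = 1.
  rewrite (sum_ffun_prod (fun _ _ => 2^-1)) big1// => j _.
  by rewrite sum_bool; field.
have m_h h : \sum_w r h w =
    \sum_(th : param d) prior nu th * \sum_(X : samples d n) Pn R th X * A X h.
  under eq_bigr do rewrite rE; rewrite exchange_big/=; apply: eq_bigr => th _.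
  rewrite -big_distrr/= exchange_big/=; congr (_ * _); apply: eq_bigr => X _.
  by rewrite -big_distrr/= -big_distrr/= sum_Ptheta mulr1.
rewrite (funext (@push_next_ker_cube d n)).
apply: (@sum_relent_ge_test _ _ _ r (P0 R (d := d)) (fun (h : clf d) v => h v)) => //.
- by move=> h v; apply: push_ge0 => // X; rewrite mulr_ge0 ?(ltW (marg_gt0 _)).
- by move: al2; lra.
have E1 : \sum_(h : clf d) \sum_(v | h v) r h v
    + \sum_(h : clf d) \sum_(v | ~~ h v) r h v = 1.
  rewrite -r_all -big_split/=; apply: eq_bigr => h _.
  by rewrite [RHS](bigID (fun v => h v)).
have -> : \sum_(h : clf d) (\sum_w r h w) * (\sum_(v | h v) P0 R v) =
   \sum_(th : param d) prior nu th * \sum_(X : samples d n) Pn R th X *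
      \sum_(h : clf d) A X h * \sum_(v | h v) P0 R v.
  under eq_bigr do rewrite m_h big_distrl/=.
  rewrite exchange_big/=; apply: eq_bigr => th _.
  under eq_bigr do rewrite -mulrA big_distrl/=.
  rewrite -big_distrr/= exchange_big/=; congr (_ * _); apply: eq_bigr => X _.
  by rewrite big_distrr/=; apply: eq_bigr => h _; rewrite mulrA.
(* Half the rejection probability under the joint law plus half the acceptance probability under the
   product law. *)
have errE : err nu A = 2^-1 * (\sum_(h : clf d) \sum_(v | ~~ h v) r h v) + 2^-1 *
   (\sum_(th : param d) prior nu th * \sum_(X : samples d n) Pn R th X *
      \sum_(h : clf d) A X h * \sum_(v | h v) P0 R v).
  rewrite (rsum (fun (h : clf d) v => ~~ h v)) /err /err_clf.
  rewrite !big_distrr -big_split/=; apply: eq_bigr => th _.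
  rewrite mulrCA [2^-1 * _ in X in _ + X]mulrCA -mulrDr; congr (_ * _).
  rewrite !big_distrr -big_split/=; apply: eq_bigr => X _.
  rewrite mulrCA [2^-1 * _ in X in _ + X]mulrCA -mulrDr; congr (_ * _).
  rewrite !big_distrr -big_split/=; apply: eq_bigr => h _.
  by ring.
move: eA; rewrite errE; lra.
Qed.

(** The constant 32 is the product of 4 from the log-odds form and 8 from the contraction. *)
Lemma memA_lower_bound d n (A : algorithm R d n) al : (0 < n)%N -> is_alg A ->
  nu * 2 ^+ n <= 1 -> err nu A <= al -> 0 < al -> al < 1 / 2 ->
  (1 - 2 * al) * ln ((1 - al) / al) / (32 * (nu ^+ 2 * 2 ^+ (2 * n)))
   + d%:R * ((1 - nu) * ln (1 - nu) + nu * ln (nu / 2)) <= memA nu A.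
Proof.
move=> n0 Aalg n1 eA al0 al2; apply: le_trans (memA_ge_mutual_info Aalg).
rewrite sum_prior_ln_prior lerD2r.
set I := \sum_h _.
have t0 : 0 < nu ^+ 2 * 2 ^+ (2 * n) by rewrite mulr_gt0 ?exprn_gt0.
rewrite ler_pdivrMr ?mulr_gt0//.
apply: le_trans (bretagnolle_huber_log_odds al0 al2) _.
have -> : I * (32 * (nu ^+ 2 * 2 ^+ (2 * n))) = 4 * (8 * (nu * 2 ^+ n) ^+ 2 * I).
  by rewrite mulnC exprM; ring.
rewrite ler_wpM2l//; apply: le_trans (mutual_info_ge n0 Aalg n1 eA al2) _.
rewrite /I big_distrr/=; apply: ler_sum => h _; apply: contracts_next_ker => // X.
by rewrite mulr_ge0 ?(ltW (marg_gt0 _))//; case: (Aalg X).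
Qed.

End Fixed.
End LowerBound.
(** * The subsampling algorithm *)

Section Subsampling.
Variable R : realType.

Lemma sum_fiber (I J : finType) (f : I -> J) (F : J -> I -> R) :
  \sum_h \sum_(w | f w == h) F h w = \sum_w F (f w) w.
Proof.
rewrite (exchange_big_dep xpredT)//=; apply: eq_bigr => w _.
by rewrite (big_pred1 (f w))// => h; rewrite eq_sym.
Qed.

Lemma sum_param_samples_prod d n
    (F : 'I_d -> option bool -> {ffun 'I_n -> bool} -> option bool -> R) :
  \sum_(th : param d) \sum_(X : samples d n) \sum_(w : param d)
     \prod_j F j (th j) (col X j) (w j)
  = \prod_j \sum_t \sum_u \sum_c F j t u c.
Proof.
rewrite -(sum_ffun_prod (fun j t => \sum_u \sum_c F j t u c)).
apply: eq_bigr => th _; rewrite -(sum_samples (fun j u => \sum_c F j (th j) u c)).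
apply: eq_bigr => X _; exact: (sum_ffun_prod (fun j => F j (th j) (col X j))).
Qed.

Section Fixed.
Variables (nu : R) (n : nat).
Hypothesis nu0 : 0 < nu.
Hypothesis nu1 : nu <= 1 / 2.
Hypothesis n_gt0 : (0 < n)%N.
Hypothesis nu_n : nu * 2 ^+ n <= 1.

Let p : R := 2^-1 ^+ n.

Let p_gt0 : 0 < p. Proof. by rewrite exprn_gt0 ?invr_gt0. Qed.

Let p_le : p <= 1 / 2.
Proof.
rewrite /p; case: n n_gt0 => // k _; rewrite exprS mul1r ler_piMr ?invr_ge0//.
by rewrite exprn_ile1// ?invr_ge0// invf_le1// ler1n.
Qed.

Let nu_p : nu <= p.
Proof.
by rewrite /p exprVn -[leRHS]mul1r ler_pdivlMr ?exprn_gt0.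
Qed.

(* [2^-n] is the smallest sampling rate, up to a constant, at which the signal [d p nu] still
   dominates the noise [sqrt (2 d p 2^-n)]. *)
Definition sel_ker (u : {ffun 'I_n -> bool}) (c : option bool) : R :=
  match c with
  | None => 1 - ((constb true u)%:R + (constb false u)%:R) * p
  | Some b => (constb b u)%:R * p
  end.

Definition score (c : option bool) (v : bool) : R :=
  match c with None => 0 | Some b => if v == b then 1 else -1 end.

Lemma constb_excl (b : bool) (u : {ffun 'I_n -> bool}) : constb b u -> constb (~~ b) u = false.
Proof.
move=> /forallP /(_ (Ordinal n_gt0)) /eqP H; apply/negbTE.
rewrite negb_forall; apply/existsP; exists (Ordinal n_gt0); rewrite H.
by case: b {H}.
Qed.

Lemma sel_ker_ge0 u c : 0 <= sel_ker u c.
Proof.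
case: c => [b|]/=; first by rewrite mulr_ge0// ltW.
move: p_le p_gt0.
by do 2 case: (constb _ u); rewrite ?mulr1n ?mulr0n; lra.
Qed.

Lemma sum_sel_ker u : \sum_c sel_ker u c = 1.
Proof. by rewrite sum_option_bool/=; ring. Qed.

Definition sel_clf d (thr : R) (w : param d) : clf d :=
  [ffun x : cube d => thr <= \sum_j score (w j) (x j)].

Definition sel_prob d (X : samples d n) (w : param d) : R :=
  \prod_j sel_ker (col X j) (w j).

(** Only the classifier is released, not the selection [w]; selections inducing the same classifier
    are merged. *)
Definition sel_alg d (thr : R) : algorithm R d n :=
  fun X h => \sum_(w | sel_clf thr w == h) sel_prob X w.

Lemma sel_prob_ge0 d (X : samples d n) w : 0 <= sel_prob X w.
Proof. by apply: prodr_ge0 => j _; exact: sel_ker_ge0. Qed.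

Lemma sum_sel_prob d (X : samples d n) : \sum_w sel_prob X w = 1.
Proof.
rewrite (sum_ffun_prod (fun j => sel_ker (col X j))) big1// => j _.
exact: sum_sel_ker.
Qed.

Lemma sel_alg_is_alg d thr : is_alg (@sel_alg d thr).
Proof.
move=> X; split=> [h|]; first by apply: sumr_ge0 => w _; exact: sel_prob_ge0.
by rewrite (sum_fiber _ (fun=> sel_prob X)) sum_sel_prob.
Qed.

(** * Error of the selection algorithm *)

(* [L t] is the law of the evaluation point on a coordinate with parameter [t]:
   [coord_lik] for a fresh sample, constant [1/2] for the null. *)
Definition score_mgf (L : option bool -> bool -> R) (l : R) : R :=
  \sum_t \sum_u \sum_c \sum_v
    coord_prior nu t * col_lik R t u * sel_ker u c * L t v * expR (l * score c v).

(** Exponential Markov: on [E] the factor [expR (y + l * score)] is at least 1, and its expectation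
    factorises over coordinates. Then [score_mgf L l] is at most [expR (score_mgf L l - 1)]. The
    sign of [l] selects the tail. *)
Lemma chernoff d (L : option bool -> bool -> R) (l y : R) (E : param d -> pred (cube d)) :
  (forall t v, 0 <= L t v) ->
  (forall w x, E w x -> 0 <= y + l * \sum_j score (w j) (x j)) ->
  \sum_(th : param d) prior nu th * \sum_(X : samples d n) Pn R th X *
    \sum_(w : param d) sel_prob X w * \sum_(x | E w x) \prod_j L (th j) (x j)
  <= expR (y + d%:R * (score_mgf L l - 1)).
Proof.
move=> L0 HE.
have mgf0 : 0 <= score_mgf L l.
  apply: sumr_ge0 => t _; apply: sumr_ge0 => u _; apply: sumr_ge0 => c _.
  apply: sumr_ge0 => v _; rewrite !mulr_ge0 ?expR_ge0 ?sel_ker_ge0 ?col_lik_ge0//.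
  exact: ltW (coord_prior_gt0 nu0 nu1 t).
apply: (@le_trans _ _ (expR y * score_mgf L l ^+ d)); last first.
  rewrite expRD ler_wpM2l ?expR_ge0// expRM_natl lerXn2r ?nnegrE ?expR_ge0//.
  by apply: le_trans (expR_ge1Dx _); rewrite addrC subrK.
have -> : score_mgf L l ^+ d = \sum_(th : param d) \sum_(X : samples d n) \sum_(w : param d)
   \prod_j \sum_v coord_prior nu (th j) * col_lik R (th j) (col X j) * sel_ker (col X j) (w j)
      * L (th j) v * expR (l * score (w j) v).
  rewrite (sum_param_samples_prod (fun j t u c => \sum_v coord_prior nu t * col_lik R t u
     * sel_ker u c * L t v * expR (l * score c v))).
  by rewrite prodr_const card_ord.
rewrite big_distrr/=; apply: ler_sum => th _; rewrite !big_distrr/=.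
apply: ler_sum => X _; rewrite !big_distrr/=; apply: ler_sum => w _.
rewrite -(sum_ffun_prod (fun j v => coord_prior nu (th j) * col_lik R (th j) (col X j)
  * sel_ker (col X j) (w j) * L (th j) v * expR (l * score (w j) v))).
under [X in _ <= _ * X]eq_bigr do rewrite !big_split/=.
rewrite !big_distrr/= big_mkcond/=; apply: ler_sum => x _.
rewrite -Pn_col -/(prior nu th) -/(sel_prob X w) -expR_sum -big_distrr/=.
have G0 : 0 <= prior nu th * (Pn R th X * (sel_prob X w * \prod_j L (th j) (x j))).
  apply: mulr_ge0; first exact: ltW (prior_gt0 nu0 nu1 th).
  apply: mulr_ge0; first exact: Pn_ge0.
  by apply: mulr_ge0; [exact: sel_prob_ge0 | apply: prodr_ge0].
case: ifP => [Ewx|_]; last first.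
  rewrite mulr_ge0 ?expR_ge0// mulr_ge0 ?expR_ge0//.
  by move: G0; rewrite !mulrA.
have -> : expR y * (prior nu th * Pn R th X * sel_prob X w * (\prod_j L (th j) (x j)) *
   expR (l * \sum_j score (w j) (x j))) =
   prior nu th * (Pn R th X * (sel_prob X w * \prod_j L (th j) (x j))) *
   expR (y + l * \sum_j score (w j) (x j)) by rewrite expRD; ring.
by rewrite ler_peMr// -[leLHS]expR0 ler_expR HE.
Qed.

Lemma sum_p : \sum_(u : {ffun 'I_n -> bool}) p = 1.
Proof.
by rewrite -[RHS](sum_col_lik R n None); apply: eq_bigr => u _; rewrite col_lik_None.
Qed.

(** As functions of the column, the terms of [score_mgf] reduce to combinations of the uniform mass
    [p] and the two constancy indicators. *)
Lemma sum_affine (x y z : R) :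
  \sum_(u : {ffun 'I_n -> bool}) (x * p + (y * (constb true u)%:R + z * (constb false u)%:R))
  = x + (y + z).
Proof. by rewrite !big_split/= -!big_distrr/= sum_p !sum_constb !mulr1. Qed.

(** An unplanted coordinate is kept with probability [2 * p * p] and then scores a fair sign; a
    planted one is kept with probability [p] and always agrees with a fresh point. *)
Lemma score_mgf_planted l : score_mgf (@coord_lik R) l =
  1 + (1 - nu) * (2 * p * p) * ((expR l + expR (- l)) / 2 - 1) + nu * p * (expR l - 1).
Proof.
rewrite /score_mgf sum_option_bool; set g := (expR l + _) / 2 - 1.
have -> : 1 + (1 - nu) * (2 * p * p) * g + nu * p * (expR l - 1) =
  ((1 - nu) + ((1 - nu) * p * p * g + (1 - nu) * p * p * g))
  + ((0 + (nu / 2 * (1 + p * (expR l - 1)) + 0))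
  + (0 + (0 + nu / 2 * (1 + p * (expR l - 1))))) by field.
congr (_ + (_ + _)); rewrite -[RHS]sum_affine; apply: eq_bigr => u _.
- rewrite sum_option_bool !sum_bool/= col_lik_None -/p !mulr0 expR0 !(mulr1, mulrN1) /g.
  by field.
- rewrite sum_option_bool !sum_bool/= col_lik_Some !mulr0 expR0 !(mulr1, mulrN1).
  case: (boolP (constb true u)) => [/constb_excl/= ->|_].
    by rewrite mulr1n mulr0n; ring.
  by rewrite mulr0n; ring.
- rewrite sum_option_bool !sum_bool/= col_lik_Some !mulr0 expR0 !(mulr1, mulrN1).
  case: (boolP (constb false u)) => [/constb_excl/= ->|_].
    by rewrite mulr1n mulr0n; ring.
  by rewrite mulr0n; ring.
Qed.

(** Against a uniform point every kept coordinate scores a fair sign, planted or not. *)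
Lemma score_mgf_null l : score_mgf (fun _ _ => 2^-1) l =
  1 + ((1 - nu) * (2 * p) + nu) * p * ((expR l + expR (- l)) / 2 - 1).
Proof.
rewrite /score_mgf sum_option_bool; set g := (expR l + _) / 2 - 1.
have -> : 1 + ((1 - nu) * (2 * p) + nu) * p * g =
  ((1 - nu) + ((1 - nu) * p * p * g + (1 - nu) * p * p * g))
  + ((0 + (nu / 2 * (1 + p * g) + 0))
  + (0 + (0 + nu / 2 * (1 + p * g)))) by field.
congr (_ + (_ + _)); rewrite -[RHS]sum_affine; apply: eq_bigr => u _.
- rewrite sum_option_bool !sum_bool/= col_lik_None -/p !mulr0 expR0 !(mulr1, mulrN1) /g.
  by field.
- rewrite sum_option_bool !sum_bool/= col_lik_Some !mulr0 expR0 !(mulr1, mulrN1) /g.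
  case: (boolP (constb true u)) => [/constb_excl/= ->|_].
    by rewrite mulr1n mulr0n; field.
  by rewrite mulr0n; field.
- rewrite sum_option_bool !sum_bool/= col_lik_Some !mulr0 expR0 !(mulr1, mulrN1) /g.
  case: (boolP (constb false u)) => [/constb_excl/= ->|_].
    by rewrite mulr1n mulr0n; field.
  by rewrite mulr0n; field.
Qed.

(** Half the mean score [d p nu] of a planted point; the null mean is zero. *)
Definition sel_thr d : R := d%:R * p * nu / 2.

Lemma sel_alg_err d : err nu (@sel_alg d (sel_thr d)) <= expR (- (d%:R * nu ^+ 2 / 96)).
Proof.
(* The minimiser of [- l * p * nu / 2 + 6 * p ^+ 2 * l ^+ 2], the exponent per coordinate shared by
   both tails. *)
pose l := nu * 2 ^+ n / 24.
have p2 : p * 2 ^+ n = 1 by rewrite /p exprVn mulVf// expf_neq0.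
have nuE : nu = 24 * l * p.
  have -> : 24 * l * p = nu * (p * 2 ^+ n) by rewrite /l; field.
  by rewrite p2 mulr1.
have l0 : 0 < l by rewrite !mulr_gt0 ?exprn_gt0.
have l2 : l <= 1 / 2 by rewrite /l; move: nu_n; lra.
have el : expR l <= 1 + l + 2 * l ^+ 2 by exact: expR_le_quad.
have eNl : expR (- l) <= 1 - l + 2 * l ^+ 2.
  by have := @expR_le_quad R (- l); rewrite sqrrN; apply; lra.
have g0 : 0 <= (expR l + expR (- l)) / 2 - 1.
  by have := expR_ge1Dx l; have := expR_ge1Dx (- l); lra.
have g1 : (expR l + expR (- l)) / 2 - 1 <= 2 * l ^+ 2 by lra.
set g := (expR l + expR (- l)) / 2 - 1 in g0 g1.
have d0 : 0 <= d%:R :> R by [].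
have pp0 : 0 < p * p by rewrite mulr_gt0.
have target : - (d%:R * nu ^+ 2 / 96) = - l * sel_thr d + d%:R * (p * p * (6 * l ^+ 2)).
  by rewrite /sel_thr nuE; field.
(* Of the coefficient 6, fair signs contribute 4 and the second-order part of the drift contributes
   2, through [nu <= p]. *)
have planted : score_mgf (@coord_lik R) (- l) - 1 <= - l * (nu * p) + p * p * (6 * l ^+ 2).
  rewrite score_mgf_planted opprK addrAC [expR (- l) + _]addrC -/g.
  have H1 : (1 - nu) * (2 * p * p) * g <= 2 * p * p * (2 * l ^+ 2).
    apply: ler_pM => //; first by rewrite !mulr_ge0 ?(ltW p_gt0)//; move: nu1; lra.
    rewrite -[leRHS]mul1r ler_wpM2r//; first by rewrite !mulr_ge0 ?(ltW p_gt0).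
    by move: nu0; lra.
  have H2 : nu * p * (expR (- l) - 1) <= nu * p * (- l + 2 * l ^+ 2).
    by rewrite ler_wpM2l ?mulr_ge0 ?(ltW p_gt0) ?(ltW nu0)//; lra.
  have H3 : nu * p * (2 * l ^+ 2) <= p * p * (2 * l ^+ 2).
    have nupp : nu * p <= p * p by rewrite ler_wpM2r// ltW.
    by rewrite ler_wpM2r// mulr_ge0// sqr_ge0.
  lra.
have null : score_mgf (fun _ _ => 2^-1) l - 1 <= p * p * (6 * l ^+ 2).
  rewrite score_mgf_null addrAC subrr add0r -/g.
  have H1 : (1 - nu) * (2 * p) + nu <= 3 * p.
    have : 0 <= nu * p by rewrite mulr_ge0 ?(ltW p_gt0) ?(ltW nu0).
    by move: nu_p; lra.
  have H2 : ((1 - nu) * (2 * p) + nu) * p <= 3 * p * p by rewrite ler_wpM2r ?(ltW p_gt0).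
  have : ((1 - nu) * (2 * p) + nu) * p * g <= 3 * p * p * (2 * l ^+ 2).
    apply: ler_pM => //; rewrite mulr_ge0 ?(ltW p_gt0)// addr_ge0 ?(ltW nu0)//.
    by rewrite mulr_ge0 ?mulr_ge0 ?(ltW p_gt0)//; move: nu1; lra.
  lra.
pose b1 := \sum_(th : param d) prior nu th * \sum_(X : samples d n) Pn R th X *
    \sum_(w : param d) sel_prob X w *
      \sum_(x | ~~ sel_clf (sel_thr d) w x) \prod_j coord_lik R (th j) (x j).
pose b2 := \sum_(th : param d) prior nu th * \sum_(X : samples d n) Pn R th X *
    \sum_(w : param d) sel_prob X w *
      \sum_(x | sel_clf (sel_thr d) w x) \prod_(j < d) (2^-1 : R).
have -> : err nu (@sel_alg d (sel_thr d)) = 2^-1 * b1 + 2^-1 * b2.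
  rewrite /err /b1 /b2 !big_distrr -big_split/=; apply: eq_bigr => th _.
  rewrite mulrCA [2^-1 * _ in X in _ + X]mulrCA -mulrDr; congr (_ * _).
  rewrite !big_distrr -big_split/=; apply: eq_bigr => X _.
  rewrite mulrCA [2^-1 * _ in X in _ + X]mulrCA -mulrDr; congr (_ * _).
  transitivity (\sum_(w : param d) sel_prob X w * err_clf R th (sel_clf (sel_thr d) w)).
    rewrite -(sum_fiber _ (fun h w => sel_prob X w * err_clf R th h)).
    by apply: eq_bigr => h _; rewrite big_distrl.
  rewrite !big_distrr -big_split/=; apply: eq_bigr => w _.
  by rewrite /err_clf /P0 /Ptheta; ring.
have B1 : b1 <= expR (- (d%:R * nu ^+ 2 / 96)).
  apply: le_trans (@chernoff d (@coord_lik R) (- l) (l * sel_thr d)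
    (fun w x => ~~ sel_clf (sel_thr d) w x) _ _) _.
  - exact: coord_lik_ge0.
  - move=> w x; rewrite ffunE -ltNge => /ltW H.
    by rewrite mulNr -mulrBr mulr_ge0 ?(ltW l0)// subr_ge0.
  - rewrite ler_expR target; have := ler_wpM2l d0 planted.
    by rewrite /sel_thr; lra.
have B2 : b2 <= expR (- (d%:R * nu ^+ 2 / 96)).
  apply: le_trans (@chernoff d (fun _ _ => 2^-1) l (- l * sel_thr d)
    (fun w x => sel_clf (sel_thr d) w x) _ _) _.
  - by move=> _ _; rewrite invr_ge0.
  - move=> w x; rewrite ffunE => H.
    by rewrite mulNr addrC -mulrBr mulr_ge0 ?(ltW l0)// subr_ge0.
  - by rewrite ler_expR target lerD2l ler_wpM2l.
lra.
Qed.

(** * Memory of the selection algorithm *)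

Definition sel_marg (t c : option bool) : R :=
  \sum_(u : {ffun 'I_n -> bool}) col_lik R t u * sel_ker u c.

Lemma sel_marg_None t : sel_marg t None = match t with None => 1 - 2 * p * p | Some _ => 1 - p end.
Proof.
case: t => [b|].
  transitivity (\sum_(u : {ffun 'I_n -> bool}) (1 - p) * (constb b u)%:R).
    apply: eq_bigr => u _; rewrite col_lik_Some/=.
    case: (boolP (constb b u)) => [bu|]; last by rewrite mulr0 mul0r.
    have := constb_excl bu; move: bu.
    by case: b => /= -> ->; rewrite mulr1n mulr0n; ring.
  by rewrite -big_distrr/= sum_constb mulr1.
transitivity (1 + (- p * p + - p * p)); last by ring.
rewrite -sum_affine; apply: eq_bigr => u _.
by rewrite col_lik_None/= -/p; ring.
Qed.

Lemma sel_marg_Some t b : sel_marg t (Some b) =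
  match t with None => p * p | Some b' => if b == b' then p else 0 end.
Proof.
case: t => [b'|]; last first.
  under [LHS]eq_bigr do rewrite col_lik_None/= -/p mulrC -mulrA.
  by rewrite -big_distrl/= sum_constb mul1r.
transitivity (\sum_(u : {ffun 'I_n -> bool}) (if b == b' then p else 0) * (constb b' u)%:R).
  apply: eq_bigr => u _; rewrite col_lik_Some/=.
  case: (boolP (constb b' u)) => [bu|]; last by rewrite mul0r mulr0.
  case: eqP => [->|/eqP bb]; first by rewrite bu mul1r mulr1 mul1r.
  have -> : b = ~~ b' by case: b b' bb {bu} => [] [].
  by rewrite constb_excl//= mul0r mulr0 mul0r.
by rewrite -big_distrr/= sum_constb mulr1.
Qed.

(** A pointwise bound on the information density between column and selection given [theta]. A
    planted coordinate costs nothing, its column being determined by [theta]. Otherwise keeping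
    costs [n * ln 2 <= n], and dropping costs at most [(1 - 2 * p * p)^-1 - 1 <= 4 * p * p]. *)
Definition sel_cost (t c : option bool) : R :=
  match t, c with
  | Some _, _ => 0
  | None, None => 4 * p * p
  | None, Some _ => n%:R
  end.

Lemma ln_two_pow : ln (p^-1) <= n%:R :> R.
Proof.
rewrite /p -exprVn invrK lnXn//; apply: (@ler_wMn2r R n).
by have := @ln_le_subr1 R 2; rewrite ltr0n => /(_ isT); lra.
Qed.

Lemma ln_sel_ratio t u c : 0 < col_lik R t u -> 0 < sel_ker u c ->
  0 < sel_marg t c /\ ln (sel_ker u c / sel_marg t c) <= sel_cost t c.
Proof.
have pp0 : 0 < p * p by rewrite mulr_gt0.
have pp4 : p * p <= 1 / 4.
  by have := ler_pM (ltW p_gt0) (ltW p_gt0) p_le p_le; lra.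
case: c => [b|]; rewrite ?sel_marg_None ?sel_marg_Some; last first.
  case: t => [b|].
    rewrite col_lik_Some /=; case: (boolP (constb b u)) => [bu _|]; last by rewrite ltxx.
    have -> : 1 - ((constb true u)%:R + (constb false u)%:R) * p = 1 - p.
      have := constb_excl bu; move: bu.
      by case: b => /= -> ->; rewrite mulr1n mulr0n; ring.
    by move=> H; rewrite H divff ?ln1 ?gt_eqF.
  move=> _ /= K0; have M0 : 0 < 1 - 2 * p * p by lra.
  split=> //; apply: le_trans (ln_le_subr1 (divr_gt0 K0 M0)) _.
  have : (1 - ((constb true u)%:R + (constb false u)%:R) * p) / (1 - 2 * p * p)
      <= (1 - 2 * p * p)^-1.
    by rewrite ler_pdivrMr// mulVf ?gt_eqF// gerBl mulr_ge0// ltW.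
  have : (1 - 2 * p * p)^-1 <= 1 + 4 * p * p.
    rewrite -div1r ler_pdivrMr//.
    have -> : (1 + 4 * p * p) * (1 - 2 * p * p) = 1 + (p * p) * (2 - 8 * (p * p)) by ring.
    by rewrite lerDl mulr_ge0 ?(ltW pp0)//; lra.
  lra.
case: t => [b'|].
  rewrite col_lik_Some /=; case: (boolP (constb b' u)) => [bu _|]; last by rewrite ltxx.
  case: eqP => [->|/eqP bb].
    by rewrite bu mul1r divff ?ln1 ?gt_eqF.
  have -> : b = ~~ b' by case: b b' bb {bu} => [] [].
  by rewrite constb_excl//= mul0r ltxx.
move=> _ /=; case: (constb b u); last by rewrite mul0r ltxx.
move=> _; split=> //.
have -> : 1%:R * p / (p * p) = p^-1 by field; rewrite gt_eqF.
exact: ln_two_pow.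
Qed.

Lemma out_marg_sel d thr (th : param d) h :
  out_marg (@sel_alg d thr) th h
    = \sum_(w | sel_clf thr w == h) \prod_j sel_marg (th j) (w j).
Proof.
rewrite /out_marg /sel_alg; under [LHS]eq_bigr do rewrite big_distrr/=.
rewrite exchange_big/=; apply: eq_bigr => w _.
rewrite -(sum_samples (fun j u => col_lik R (th j) u * sel_ker u (w j))).
by apply: eq_bigr => X _; rewrite big_split/= Pn_col.
Qed.

Lemma sel_marg_ge0 t c : 0 <= sel_marg t c.
Proof. by apply: sumr_ge0 => u _; rewrite mulr_ge0 ?col_lik_ge0 ?sel_ker_ge0. Qed.

Lemma prodr_gt0_inv (I : finType) (F : I -> R) :
  (forall i, 0 <= F i) -> 0 < \prod_i F i -> forall i, 0 < F i.
Proof.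
move=> F0 P0 i; rewrite lt_neqAle F0 andbT eq_sym; apply: contraTneq P0 => Fi.
by rewrite (bigD1 i)//= Fi mul0r ltxx.
Qed.

(* The log-sum inequality lets the memory of [h] be bounded by that of the selection [w]. *)
Lemma memA_sel_le_cost d thr : memA nu (@sel_alg d thr) <=
  \sum_(th : param d) prior nu th * \sum_(X : samples d n) Pn R th X *
    \sum_w sel_prob X w * \sum_j sel_cost (th j) (w j).
Proof.
apply: ler_sum => th _; rewrite ler_wpM2l ?(ltW (prior_gt0 nu0 nu1 th))//.
apply: ler_sum => X _.
have := @Pn_ge0 R d n th X; rewrite le_eqVlt => /predU1P[<-|P0].
  by rewrite mul0r big1// => h _; rewrite mul0r ltxx.
have P0j := prodr_gt0_inv (fun j => col_lik_ge0 R (th j) (col X j)).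
rewrite -Pn_col in P0j; have {}P0j := P0j P0.
have pos w : 0 < sel_prob X w -> forall j, 0 < sel_marg (th j) (w j) /\
    ln (sel_ker (col X j) (w j) / sel_marg (th j) (w j)) <= sel_cost (th j) (w j).
  move=> Kw j; apply: ln_sel_ratio (P0j j) _.
  exact: (prodr_gt0_inv (fun j => sel_ker_ge0 (col X j) (w j)) Kw).
rewrite big_distrr/=; under [leRHS]eq_bigr do rewrite mulrA.
rewrite -(sum_fiber (sel_clf thr) (fun _ w => Pn R th X * sel_prob X w
  * \sum_j sel_cost (th j) (w j))).
apply: ler_sum => h _.
have Mge0 w : 0 <= \prod_j sel_marg (th j) (w j) by apply: prodr_ge0 => j _; exact: sel_marg_ge0.
apply: (@le_trans _ _ (Pn R th X *
   (sel_alg thr X h * ln (sel_alg thr X h / out_marg (sel_alg thr) th h)))).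
  case: ifPn => [_|]; first by rewrite mulrA.
  rewrite -leNgt pmulr_rle0// => A0.
  have -> : sel_alg thr X h = 0.
    by apply/eqP; rewrite eq_le A0/=; case: (sel_alg_is_alg thr X) => H _; exact: H.
  by rewrite mul0r mulr0.
rewrite out_marg_sel /sel_alg.
under [leRHS]eq_bigr do rewrite -mulrA.
rewrite -big_distrr/= ler_wpM2l ?(ltW P0)//.
apply: le_trans (log_sum _ _ _) _.
- by move=> w _; exact: sel_prob_ge0.
- by move=> w _; exact: Mge0.
- by move=> w _ Kw; apply: prodr_gt0 => j _; case: (pos w Kw j).
apply: ler_sum => w _.
have := sel_prob_ge0 X w; rewrite le_eqVlt => /predU1P[<-|Kw]; first by rewrite !mul0r.
rewrite ler_wpM2l ?(ltW Kw)//.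
have Kj := prodr_gt0_inv (fun j => sel_ker_ge0 (col X j) (w j)) Kw.
rewrite -prodf_div ln_prod => [|j]; last by rewrite divr_gt0//; case: (pos w Kw j).
by apply: ler_sum => j _; case: (pos w Kw j).
Qed.

(** By linearity one coordinate suffices. An unplanted one is kept with probability [2 * p * p] at
    cost [n], and dropped at cost [4 * p * p]. *)
Lemma sum_sel_cost d :
  \sum_(th : param d) prior nu th * \sum_(X : samples d n) Pn R th X *
    \sum_w sel_prob X w * \sum_j sel_cost (th j) (w j)
  <= d%:R * (p * p * (2 * n%:R + 4)).
Proof.
pose F t u c := coord_prior nu t * col_lik R t u * sel_ker u c.
have F1 : \sum_t \sum_u \sum_c F t u c = 1.
  rewrite -[RHS](sum_coord_prior nu); apply: eq_bigr => t _.
  rewrite -[RHS]mulr1 -(sum_col_lik R n t) big_distrr/=; apply: eq_bigr => u _.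
  by rewrite -big_distrr/= sum_sel_ker mulr1.
have Fc j : \sum_(th : param d) \sum_(X : samples d n) \sum_(w : param d)
    (\prod_i F (th i) (col X i) (w i)) * sel_cost (th j) (w j) =
    \sum_t \sum_u \sum_c F t u c * sel_cost t c.
  (* Moving the cost into the factor at [j] restores the product form; all other factors sum to
     1. *)
  transitivity (\sum_(th : param d) \sum_(X : samples d n) \sum_(w : param d)
    \prod_i (F (th i) (col X i) (w i) * (if i == j then sel_cost (th i) (w i) else 1))).
    apply: eq_bigr => th _; apply: eq_bigr => X _; apply: eq_bigr => w _.
    by rewrite [RHS]big_split/=; congr (_ * _); rewrite -big_mkcond/= big_pred1_eq.
  rewrite (sum_param_samples_prod (fun i t u c => F t u c * (if i == j then sel_cost t c else 1))).
  rewrite (bigD1 j)//= eqxx [X in _ * X]big1 ?mulr1// => i /negPf ->.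
  by under eq_bigr do under eq_bigr do under eq_bigr do rewrite mulr1.
have -> : \sum_(th : param d) prior nu th * \sum_(X : samples d n) Pn R th X *
    \sum_w sel_prob X w * \sum_j sel_cost (th j) (w j) =
    \sum_(j < d) \sum_t \sum_u \sum_c F t u c * sel_cost t c.
  under [RHS]eq_bigr => j _ do rewrite -(Fc j).
  rewrite exchange_big/=; apply: eq_bigr => th _.
  rewrite exchange_big big_distrr/=; apply: eq_bigr => X _.
  rewrite exchange_big !big_distrr/=; apply: eq_bigr => w _.
  rewrite !big_distrr/=; apply: eq_bigr => j _.
  by rewrite /F !big_split/= -Pn_col !mulrA.
rewrite sumr_const card_ord -[leLHS]mulr_natl ler_wpM2l//.
rewrite sum_option_bool [X in _ + X](_ : _ = 0); last first.
  by rewrite !big1 ?addr0// => u _; rewrite big1// => c _; rewrite /= mulr0.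
rewrite addr0.
have -> : \sum_u \sum_c F None u c * sel_cost None c =
    (1 - nu) * (\sum_c sel_marg None c * sel_cost None c).
  rewrite exchange_big big_distrr/=; apply: eq_bigr => c _.
  rewrite -big_distrl/= [RHS]mulrA; congr (_ * _); rewrite big_distrr/=.
  by apply: eq_bigr => u _; rewrite /F mulrA.
rewrite sum_option_bool sel_marg_None !sel_marg_Some/=.
have pp0 : 0 <= p * p by rewrite mulr_ge0// ltW.
have pp4 : 0 <= p * p * (p * p) by rewrite mulr_ge0.
have nn0 : 0 <= p * p * n%:R by rewrite mulr_ge0.
have B : (1 - 2 * p * p) * (4 * p * p) + (p * p * n%:R + p * p * n%:R)
    <= p * p * (2 * n%:R + 4) by lra.
have B0 : 0 <= (1 - 2 * p * p) * (4 * p * p) + (p * p * n%:R + p * p * n%:R).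
  have : p * p <= 1 / 4 by have := ler_pM (ltW p_gt0) (ltW p_gt0) p_le p_le; lra.
  move=> pq; rewrite addr_ge0 ?addr_ge0// mulr_ge0//; last by lra.
  lra.
apply: le_trans B; rewrite -[leRHS]mul1r ler_wpM2r//; move: nu0; lra.
Qed.

Lemma memA_sel_le d thr :
  memA nu (@sel_alg d thr) <= d%:R * (2 * n%:R + 4) / 2 ^+ (2 * n).
Proof.
apply: le_trans (memA_sel_le_cost d thr) _; apply: le_trans (sum_sel_cost d) _.
apply: eq_ler; rewrite /p exprVn mulnC exprM; field.
by rewrite expf_neq0.
Qed.

End Fixed.
End Subsampling.
(** * Choice of constants *)

(* [D = d^(1/16)], so that [n <= (1/16) ln d] reads [n <= ln D] and gives [2^n <= D]. *)
Section Asymptotics.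
Variables (R : realType) (C D : R) (d : nat).
Hypothesis C_ge : 100 <= C.
Hypothesis D_ge : 12288 * C <= D.
Hypothesis dE : d%:R = D ^+ 16.

Let nu : R := C / Num.sqrt d%:R.

Let D_ge1 : 1 <= D. Proof. by move: C_ge D_ge; lra. Qed.

Let C_gt0 : 0 < C. Proof. by move: C_ge; lra. Qed.

Let D_gt0 : 0 < D. Proof. by move: D_ge1; lra. Qed.

Lemma sqrt_dE : Num.sqrt (d%:R : R) = D ^+ 8.
Proof. by rewrite dE -[16%N]/(8 * 2)%N exprM sqrtr_sqr ger0_norm// exprn_ge0// ltW. Qed.

Lemma nuE : nu = C / D ^+ 8.
Proof. by rewrite /nu sqrt_dE. Qed.

Lemma nu_gt0 : 0 < nu.
Proof. by rewrite nuE divr_gt0 ?exprn_gt0. Qed.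

Lemma le_D_expn k : (0 < k)%N -> D <= D ^+ k.
Proof. by move=> k0; rewrite -[leLHS]expr1 ler_weXn2l. Qed.

Lemma nu_le_half : nu <= 1 / 2.
Proof.
rewrite nuE ler_pdivrMr ?exprn_gt0//.
by have := @le_D_expn 8 isT; move: D_ge C_gt0; lra.
Qed.

Lemma lnD_ge1 : 1 <= ln D.
Proof.
(* The bound [expR (1 / 2) <= 2] gives [expR 1 <= 4 <= D]. *)
have := @expR_le_quad R (1 / 2) (lexx _).
have -> : 1 + 1 / 2 + 2 * (1 / 2) ^+ 2 = 2 :> R by field.
move=> e2; rewrite -ler_expR lnK ?posrE//.
have -> : 1 = 1 / 2 + 1 / 2 :> R by field.
rewrite expRD; have := ler_pM (expR_ge0 _) (expR_ge0 _) e2 e2.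
by move: D_ge C_ge; lra.
Qed.

Lemma ln_dE : ln (d%:R : R) = 16 * ln D.
Proof. by rewrite dE lnXn// mulr_natl. Qed.

Section Samples.
Variable n : nat.
Hypothesis n_gt0 : (0 < n)%N.
Hypothesis n_le : n%:R <= ln D.

Lemma two_pow_le : 2 ^+ n <= D.
Proof.
apply: (@le_trans _ _ (expR 1 ^+ n)).
  by rewrite lerXn2r ?nnegrE ?expR_ge0//; have := @expR_ge1Dx R 1; lra.
by rewrite -expRM_natl mulr1 -[leRHS]lnK ?posrE// ler_expR.
Qed.

Lemma nu_two_pow_le1 : nu * 2 ^+ n <= 1.
Proof.
apply: (@le_trans _ _ (nu * D)); first by rewrite ler_wpM2l ?two_pow_le// ltW ?nu_gt0.
rewrite nuE mulrAC ler_pdivrMr ?exprn_gt0// mul1r exprS mulrC ler_wpM2l ?(ltW D_gt0)//.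
by have := @le_D_expn 7 isT; move: D_ge C_gt0; lra.
Qed.

Lemma d_nu2 : d%:R * nu ^+ 2 = C ^+ 2.
Proof. by rewrite nuE dE; field; rewrite gt_eqF. Qed.

Lemma sel_alg_correct : exists A : algorithm R d n,
  [/\ is_alg A, err nu A <= 1 / 100
    & memA nu A <= 6 * (d%:R * ln (d%:R : R)) / 2 ^+ (2 * n)].
Proof.
have [[h0 h1] h2] := (nu_gt0, nu_le_half, nu_two_pow_le1).
exists (@sel_alg R n d (@sel_thr R nu n d)); split.
- exact: sel_alg_is_alg.
- apply: le_trans (sel_alg_err h0 h1 n_gt0 h2 d) _.
  rewrite d_nu2 expRN -div1r ler_pdivrMr ?expR_gt0//.
  (* Since [C >= 100], the exponent [C ^+ 2 / 96] exceeds 104, and [expR t >= 1 + t] already gives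
     error below 1/100. *)
  have : 10000 <= C ^+ 2 by have := ler_pM _ _ C_ge C_ge; lra.
  have := @expR_ge1Dx R (C ^+ 2 / 96); lra.
- apply: le_trans (memA_sel_le h0 h1 n_gt0 d _) _.
  rewrite ler_wpM2r ?invr_ge0 ?exprn_ge0// mulrCA ler_wpM2l//.
  have : 1 <= n%:R :> R by rewrite ler1n.
  by move: n_le lnD_ge1; rewrite ln_dE; lra.
Qed.

(** Here [d nu = C sqrt d], and per unit of [nu] the entropy is at most [1 + ln d], because
    [(1 - nu) * ln (1 - nu) >= - nu] and [nu / 2 >= 1 / d]. *)
Lemma entropy_le :
  - (2 * C * (Num.sqrt d%:R * ln (d%:R : R)))
   <= d%:R * ((1 - nu) * ln (1 - nu) + nu * ln (nu / 2)).
Proof.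
have [h0 h1] := (nu_gt0, nu_le_half).
have dnu : d%:R * nu = C * D ^+ 8 by rewrite nuE dE; field; rewrite gt_eqF.
have -> : - (2 * C * (Num.sqrt d%:R * ln (d%:R : R))) = d%:R * nu * (- 2 * ln (d%:R : R)).
  by rewrite dnu sqrt_dE; ring.
rewrite -mulrA ler_wpM2l//.
have H1 : - nu <= (1 - nu) * ln (1 - nu).
  have nu1' : 0 < 1 - nu by lra.
  have := ler_wpM2l (ltW nu1') (ln_ge_subV1 nu1').
  by rewrite mulrBr mulr1 divff ?gt_eqF//; lra.
have H2 : - ln (d%:R : R) <= ln (nu / 2).
  have nu2_gt0 : 0 < nu / 2 by move: h0; lra.
  rewrite -lnV ?posrE ?dE ?exprn_gt0// ler_ln ?posrE ?invr_gt0 ?exprn_gt0//.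
  rewrite nuE -div1r ler_pdivrMr ?exprn_gt0//.
  have -> : C / D ^+ 8 / 2 * D ^+ 16 = C / 2 * D ^+ 8.
    by field; rewrite gt_eqF.
  have D81 : 1 <= D ^+ 8 by rewrite exprn_ege1.
  have C2 : 1 <= C / 2 by move: C_ge; lra.
  by have := ler_pM ler01 ler01 C2 D81; lra.
have H3 : nu * (- ln (d%:R : R)) <= nu * ln (nu / 2).
  exact: (ler_wpM2l (ltW h0) H2).
have H4 : nu * 1 <= nu * ln (d%:R : R).
  by rewrite ler_wpM2l ?(ltW h0)// ln_dE; move: lnD_ge1; lra.
lra.
Qed.

Lemma memP_ge al : 0 < al -> al < 1 / 2 ->
  ((1 / 32 * ((1 - 2 * al) * ln ((1 - al) / al)) / (nu ^+ 2 * 2 ^+ (2 * n))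
     - 2 * C * (Num.sqrt d%:R * ln (d%:R : R)))%:E <= memP d n nu al)%E.
Proof.
move=> al0 al2; apply: le_ereal_inf_tmp => _ [A [Aalg eA] <-]; rewrite lee_fin.
apply: le_trans (memA_lower_bound nu_gt0 nu_le_half n_gt0 Aalg nu_two_pow_le1 eA al0 al2).
rewrite lerD ?entropy_le//; apply: eq_ler.
have : nu ^+ 2 * 2 ^+ (2 * n) != 0 by rewrite gt_eqF// mulr_gt0 ?exprn_gt0 ?nu_gt0.
by move: (nu ^+ 2 * 2 ^+ (2 * n)) => b b0; field.
Qed.

(** With [T = d / (2 ^+ (2 * n) * C ^+ 2)], the main term is at least [T / 192] and the entropy
    loss, of order [D ^+ 9] against [T >= D ^+ 14 / C ^+ 2], is at most [T / 384]. *)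
Lemma memP_third_ge : ((1 / (384 * C ^+ 2) * d%:R / 2 ^+ (2 * n))%:E <= memP d n nu (1 / 3))%E.
Proof.
apply: (le_trans _ (memP_ge _ _)); [|lra|lra].
rewrite lee_fin.
set t : R := 2 ^+ (2 * n).
have t0 : 0 < t by rewrite exprn_gt0.
have tD : t <= D ^+ 2.
  by rewrite /t mulnC exprM lerXn2r ?nnegrE ?exprn_ge0 ?(ltW D_gt0) ?two_pow_le.
have ln2 : 1 / 2 <= ln ((1 - 1 / 3) / (1 / 3) : R).
  have -> : (1 - 1 / 3) / (1 / 3) = 2 :> R by field.
  by have := @ln_ge_subV1 R 2; rewrite ltr0n => /(_ isT); lra.
have nu2 : (nu ^+ 2 * t)^-1 = d%:R / t / C ^+ 2.
  rewrite -d_nu2; field.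
  by rewrite !gt_eqF ?nu_gt0// dE exprn_gt0.
pose T := d%:R / t / C ^+ 2.
have T0 : 0 <= T by rewrite !divr_ge0 ?exprn_ge0 ?(ltW t0) ?(ltW C_gt0).
have G : 2 * C * (Num.sqrt d%:R * ln (d%:R : R)) <= 32 * C * D ^+ 9.
  rewrite sqrt_dE ln_dE exprS.
  have : C * D ^+ 8 * ln D <= C * D ^+ 8 * D.
    by rewrite ler_wpM2l ?(ltW (ln_sublinear _))// mulr_ge0 ?exprn_ge0 ?ltW.
  lra.
(* The constant is [12288 = 384 * 32], which turns the loss [32 * C * D ^+ 9] into at most
   [T / 384]. *)
have T14 : 12288 * C * D ^+ 9 <= T.
  rewrite /T ler_pdivlMr ?exprn_gt0// ler_pdivlMr// dE.
  apply: (@le_trans _ _ (12288 * C * D ^+ 9 * C ^+ 2 * D ^+ 2)).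
    have P : 0 <= C * D ^+ 9 * C ^+ 2.
      by rewrite ltW// mulr_gt0 ?exprn_gt0// mulr_gt0 ?exprn_gt0.
    by apply: ler_wpM2l tD; lra.
  have CD : C <= D by move: D_ge C_gt0; lra.
  have -> : 12288 * C * D ^+ 9 * C ^+ 2 * D ^+ 2 = 12288 * C * C ^+ 2 * D ^+ 11 by ring.
  have -> : D ^+ 16 = D * D ^+ 2 * D ^+ 2 * D ^+ 11 by ring.
  rewrite ler_wpM2r ?exprn_ge0 ?(ltW D_gt0)//.
  have C2D2 : C ^+ 2 <= D ^+ 2 by rewrite lerXn2r ?nnegrE ?(ltW C_gt0) ?(ltW D_gt0).
  have D21 : 1 <= D ^+ 2 by rewrite exprn_ege1.
  apply: (@le_trans _ _ (D * D ^+ 2)).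
    have K0 : 0 <= 12288 * C by move: C_gt0; lra.
    exact: (ler_pM K0 (sqr_ge0 C) D_ge C2D2).
  have D3 : 0 <= D * D ^+ 2 by rewrite ltW// mulr_gt0 ?exprn_gt0.
  by have := ler_wpM2l D3 D21; rewrite mulr1.
(* Here [1 / 192 = 1 / 32 * 1 / 3 * 1 / 2], with [ln 2 >= 1 / 2]. *)
have L : 1 / 192 * T <= 1 / 32 * ((1 - 2 * (1 / 3)) * ln ((1 - 1 / 3) / (1 / 3))) / (nu ^+ 2 * t).
  rewrite nu2 -/T ler_wpM2r//; lra.
have -> : 1 / (384 * C ^+ 2) * d%:R / t = 1 / 384 * T.
  by rewrite /T; field; rewrite !gt_eqF.
lra.
Qed.

End Samples.
End Asymptotics.

Theorem mainTheorem11 (R : realType) :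
  exists C0 : R, 0 < C0 /\
  forall C : R, C0 <= C ->
  exists c : R, 0 < c /\
  exists K1 K2 K3 K4 : R, [/\ 0 < K1, 0 < K2, 0 < K3 & 0 < K4] /\
  exists d0 : nat, forall d : nat, (d0 <= d)%N ->
    let nu : R := C / Num.sqrt (d%:R) in
    (* (1) a single-sample algorithm with error <= 0.01 *)
    (exists A : algorithm R d 1, is_alg A /\ err nu A <= 1 / 100) /\
    forall n : nat, (1 <= n)%N -> n%:R <= c * ln (d%:R : R) ->
      (* (2) memorization lower bound, for every alpha < 1/2 *)
      (forall alpha : R, 0 < alpha -> alpha < 1 / 2 ->
         ((K1 * ((1 - 2 * alpha) * ln ((1 - alpha) / alpha))
                / (nu ^+ 2 * 2 ^+ (2 * n))
           - K2 * (Num.sqrt (d%:R) * ln (d%:R : R)))%:E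
          <= memP d n nu alpha)%E)
      /\ ((K3 * d%:R / 2 ^+ (2 * n))%:E <= memP d n nu (1 / 3))%E
      (* (3) a low-memorization algorithm with error <= 0.01 *)
      /\ (exists A : algorithm R d n,
            [/\ is_alg A, err nu A <= 1 / 100
              & memA nu A <= K4 * (d%:R * ln (d%:R : R)) / 2 ^+ (2 * n)]).
Proof.
exists 100; split; first by lra.
move=> C C_ge; exists (1 / 16); split; first by lra.
have C0 : 0 < C by lra.
exists (1 / 32), (2 * C), (1 / (384 * C ^+ 2)), 6; split.
  have C2 : 0 < C ^+ 2 by exact: exprn_gt0.
  by split; [lra | lra | apply: divr_gt0; lra | lra].
have [B BE] : exists B : R, B = 12288 * C by exists (12288 * C).
have B0 : 0 < B by lra.
(* Beyond this threshold [d >= B ^+ 16], which is [D >= 12288 * C] for the sixteenth root [D] of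
   [d]. *)
exists (Num.bound (B ^+ 16)) => d d_ge nu.
have d_ge' : B ^+ 16 <= d%:R :> R.
  apply: le_trans (ltW (archi_boundP (ltW (exprn_gt0 16 B0)))) _.
  by rewrite ler_nat.
have d_gt0 : 0 < d%:R :> R by exact: lt_le_trans (exprn_gt0 16 B0) d_ge'.
pose D : R := expR (ln d%:R / 16).
have dE : d%:R = D ^+ 16.
  by rewrite /D -expRM_natl mulrC divfK ?pnatr_eq0// lnK.
have D_ge : 12288 * C <= D.
  by rewrite -BE -(@ler_pXn2r R 16) ?nnegrE ?expR_ge0 ?(ltW B0)// -dE.
have lnDE : ln d%:R = 16 * ln D := ln_dE C_ge D_ge dE.
split.
  (* The single-sample claim is the subsampling algorithm at [n = 1], within range because
     [ln D >= 1]. *)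
  have n1 : 1%:R <= ln D by exact: (lnD_ge1 C_ge D_ge).
  by have [A [A_alg A_err _]] := sel_alg_correct C_ge D_ge dE (ltn0Sn 0) n1; exists A.
move=> n n_gt0 n_le.
have n_le' : n%:R <= ln D.
  by apply: le_trans n_le _; rewrite lnDE mulrA div1r mulVf ?pnatr_eq0// mul1r.
split; [|split].
- by move=> al al0 al2; exact: (memP_ge C_ge D_ge dE n_gt0 n_le' al0 al2).
- exact: (memP_third_ge C_ge D_ge dE n_gt0 n_le').
- exact: (sel_alg_correct C_ge D_ge dE n_gt0 n_le').
Qed.
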